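(* Let $M$ be a finitely generated multigraded $S$-module with minimal multigraded free resolution $$\mathbb{F}:\ 0\to F_p \xrightarrow{\varphi_p} F_{p-1}\to \cdots \to F_1 \xrightarrow{\varphi_1} F_0\to 0,$$ where $F_i=\bigoplus_j S(-\mathbf{a}_{ij})$ for $i=0,\ldots,p$. Let $M^*$ be the expansion of $M$ with respect to $(i_1,i_2,\ldots,i_n)$. Then $$\beta_{jk}(M^* )=\sum_{i=0}^p \beta_{j-i,k}(F_i^* )\qquad\text{for all } j \text{ and } k.$$ Moreover, $\operatorname{reg}(M)=\operatorname{reg}(M^* )$ and $$\operatorname{proj\,dim} M^*=\max_{i,j}\Big\{\,i+\sum_{k\in \operatorname{supp}(\mathbf{a}_{ij})}(i_k-1)\Big\}.$$
   Context: Let $K$ be a field and $S=K[x_1,\ldots,x_n]$. Fix an $n$-tuple $(i_1,\ldots,i_n)$ of positive integers, let $S^*$ be the polynomial ring over $K$ in the variables $x_{jk}$, $1\le j\le n$, $1\le k\le i_j$, and set $P_j=(x_{j1},\ldots,x_{ji_j})\subseteq S^*$. For a monomial $\mathbf{x}^{\mathbf{a}}\in S$, $\mathbf{a}=(a(1),\ldots,a(n))\in\mathbb{N}^n$, put $(\mathbf{x}^{\mathbf{a}})^*=P_1^{a(1)}\cdots P_n^{a(n)}\subseteq S^*$. Polynomial rings carry the standard multigrading (by exponent vectors of monomials). Multigraded $S$-modules are understood to be $\mathbb{N}^n$-graded, so all shifts of multigraded free modules lie in $\mathbb{N}^n$; free modules are finitely generated. Expansion functor. For $F=\bigoplus_i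 S(-\mathbf{a}_i)$ put $F^*=\bigoplus_i(\mathbf{x}^{\mathbf{a}_i})^*$, a (generally non-free) multigraded $S^*$-module. A multigraded homomorphism $\alpha:\bigoplus_{i=1}^r S(-\mathbf{a}_i)\to\bigoplus_{j=1}^s S(-\mathbf{b}_j)$ has components $S(-\mathbf{a}_i)\to S(-\mathbf{b}_j)$, $f\mapsto \lambda_{ji}\mathbf{x}^{\mathbf{a}_i-\mathbf{b}_j}f$, with $\lambda_{ji}\in K$ and $\lambda_{ji}=0$ if $\mathbf{x}^{\mathbf{b}_j}\nmid\mathbf{x}^{\mathbf{a}_i}$. Define $\alpha^*:\bigoplus_i(\mathbf{x}^{\mathbf{a}_i})^*\to\bigoplus_j(\mathbf{x}^{\mathbf{b}_j})^*$ as the map with components $f\mapsto\lambda_{ji}f$ if $\mathbf{x}^{\mathbf{b}_j}\mid\mathbf{x}^{\mathbf{a}_i}$ (note that then $(\mathbf{x}^{\mathbf{a}_i})^*\subseteq(\mathbf{x}^{\mathbf{b}_j})^*$), and zero otherwise. For a finitely generated multigraded $S$-module $M$, choose a multigraded free presentation $F_1\xrightarrow{\varphi}F_0\to M\to0$ and set $M^*=\operatorname{Coker}\varphi^*$ (well defined up to isomorphism); $M^*$ is called the expansion of $M$ with respect to $(i_1,\ldots,i_n)$. Here $\beta_{jk}(N)$ denotes the graded Betti number in homological degree $j$ and total degree $k$ (over $S^*$ for $S^*$-modules, zero for $j<0$), $\operatorname{reg}$ is Castelnuovo–Mumford regularity with respect to total degree (over $S$ for $M$, over $S^*$ for $M^*$),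 and $\operatorname{supp}(\mathbf{a})=\{k: a(k)\neq0\}$. *)

(* Defs.v *)
From HB Require Import structures.
From mathcomp Require Import all_boot all_order all_algebra.
From mathcomp Require Import ring_quotient generic_quotient.
From mathcomp Require Import boolp.
From mathcomp Require Import mpoly.
(* The notations of constructive_ereal are incompatible with those of mpoly. *)
From mathcomp Require Import -(notations) constructive_ereal.

Set Implicit Arguments.
Unset Strict Implicit.
Unset Printing Implicit Defensive.
Import Order.TTheory GRing.Theory Num.Theory.
Local Open Scope ring_scope.

(** * Suprema in Z extended by -oo and +oo *)

Notation eint := (extended int).
Notation efin := (@EFin int).
Notation eNoo := (@ENInf int).

Definition is_esup (A : eint -> Prop) (u : eint) : Prop :=
  (forall x, A x -> (x <= u)%O) /\
  (forall w, (forall x, A x -> (x <= w)%O) -> (u <= w)%O).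

Definition is_einf (A : eint -> Prop) (u : eint) : Prop :=
  (forall x, A x -> (u <= x)%O) /\
  (forall w, (forall x, A x -> (w <= x)%O) -> (w <= u)%O).

(* Suprema and infima always exist in [eint], so the default value is never
   used; the supremum of the empty set is -oo. *)
Definition esup (A : eint -> Prop) : eint :=
  if pselect (exists u, is_esup A u) is left ex then projT1 (cid ex) else eNoo.

Definition einf (A : eint -> Prop) : eint :=
  if pselect (exists u, is_einf A u) is left ex then projT1 (cid ex) else eNoo.

(** * Ideals, as predicates *)

Section Ideals.
Variable R : comNzRingType.
Implicit Types (G I J : R -> Prop).

Definition ideal_gen G (f : R) : Prop :=
  exists s : seq (R * R),
    (forall cg, cg \in s -> G cg.2) /\ f = \sum_(cg <- s) cg.1 * cg.2.

Definition ideal_one (f : R) : Prop := True.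

Definition ideal_mul I J : R -> Prop :=
  ideal_gen (fun f => exists g h, [/\ I g, J h & f = g * h]).

Definition ideal_exp I (a : nat) : R -> Prop := iter a (ideal_mul I) ideal_one.

Definition is_ideal I : Prop :=
  I 0 /\ forall c f g, I f -> I g -> I (c * f + g).

Lemma ideal_gen_ideal G : is_ideal (ideal_gen G).
Proof.
split; first by exists [::]; rewrite big_nil; split.
move=> c f g [s [sG ->]] [t [tG ->]].
exists ([seq (c * cg.1, cg.2) | cg <- s] ++ t); split.
  by move=> cg; rewrite mem_cat => /orP[/mapP[x /sG Gx ->] //|/tG].
rewrite big_cat big_map /= mulr_sumr; congr (_ + _).
by apply: eq_bigr => cg _; rewrite mulrA.
Qed.

Lemma ideal_gen_in G f : G f -> ideal_gen G f.
Proof.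
move=> Gf; exists [:: (1, f)]; rewrite big_seq1 mul1r; split=> //.
by move=> cg; rewrite inE => /eqP->.
Qed.

Lemma ideal_gen_sub G I : is_ideal I -> (forall f, G f -> I f) ->
  forall f, ideal_gen G f -> I f.
Proof.
move=> [I0 Icl] GI f [s [sG ->]]; elim: s sG => [|cg s IHs] sG.
  by rewrite big_nil.
rewrite big_cons; apply: Icl; first by apply/GI/sG; rewrite inE eqxx.
by apply: IHs => x xs; apply: sG; rewrite inE xs orbT.
Qed.

Lemma ideal_mul_mono I I' J J' :
    (forall f, I f -> I' f) -> (forall f, J f -> J' f) ->
  forall f, ideal_mul I J f -> ideal_mul I' J' f.
Proof.
move=> II JJ; apply: ideal_gen_sub (ideal_gen_ideal _) _ => _ [g [h [Ig Jh ->]]].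
by apply: ideal_gen_in; exists g, h; split; [exact: II | exact: JJ |].
Qed.

Lemma ideal_exp_ideal I a : is_ideal (ideal_exp I a).
Proof. by case: a => [|a]; [|exact: ideal_gen_ideal]. Qed.

Lemma ideal_exp_mono I a b : (b <= a)%N ->
  forall f, ideal_exp I a f -> ideal_exp I b f.
Proof.
elim: a b => [|a IHa] [|b] //= leba.
exact: ideal_mul_mono (fun _ => id) (IHa b leba).
Qed.

End Ideals.

(** * Multigraded modules over K[x_1, ..., x_n] *)

Section GradedModules.
Variables (K : fieldType) (n : nat).
Local Notation S := {mpoly K[n]}.

(* [mgcomp M a] is the component of [M] of multidegree [a] *)
Record grmod := GrMod {
  carrier :> lmodType S;
  mgcomp : 'X_{1..n} -> carrier -> Prop }.

Definition multigraded (M : grmod) : Prop :=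
  [/\ forall a, mgcomp a (0 : M) /\
        (forall (c : K) (x y : M),
          mgcomp a x -> mgcomp a y -> mgcomp a (c%:MP *: x + y)),
      forall a b (x : M), mgcomp a x -> mgcomp (b + a)%MM ('X_[b] *: x),
      forall x : M, exists (s : seq 'X_{1..n}) (f : 'X_{1..n} -> M),
        (forall a, mgcomp a (f a)) /\ x = \sum_(a <- s) f a
    & forall (s : seq 'X_{1..n}) (f : 'X_{1..n} -> M),
        uniq s -> (forall a, mgcomp a (f a)) -> \sum_(a <- s) f a = 0 ->
        forall a, a \in s -> f a = 0].

(* the component of total degree [k], the sum of the components of
   multidegree [a] for |a| = k *)
Definition totcomp (M : grmod) (k : nat) (x : M) : Prop :=
  exists s : seq M,
    (forall y, y \in s -> exists2 a, mdeg a = k & mgcomp a y) /\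
    x = \sum_(y <- s) y.

Definition maxideal : S -> Prop := ideal_gen (fun f => exists i, f = 'X_i).

End GradedModules.

Definition finitely_generated (R : nzRingType) (N : lmodType R) : Prop :=
  exists s : seq N, forall x, exists c : 'I_(size s) -> R,
    x = \sum_(i < size s) c i *: s`_i.

(** * Free resolutions, graded Betti numbers, regularity *)

(* ... -> R^(rank 1) -> R^(rank 0) -> N; elements of R^r are row vectors, on
   which matrices act on the right *)
Record free_cplx (R : nzRingType) (N : lmodType R) := FreeCplx {
  rank : nat -> nat;
  dif : forall i, 'M[R]_(rank i.+1, rank i);
  aug : {linear 'rV[R]_(rank 0) -> N} }.

Definition is_free_resolution (R : nzRingType) (N : lmodType R)
    (F : free_cplx N) : Prop :=
  [/\ forall x, exists c, aug F c = x,
      forall c, aug F c = 0 <-> exists b, c = b *m dif F 0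
    & forall i (c : 'rV_(rank F i.+1)),
        c *m dif F i = 0 <-> exists b, c = b *m dif F i.+1].

Section Betti.
Variables (K : fieldType) (n : nat).
Implicit Type M : grmod K n.

(* F_i is mapped into (x_1, ..., x_n) F_(i-1) for all i > 0 *)
Definition is_minimal M (F : free_cplx M) : Prop :=
  forall i u v, maxideal (dif F i u v).

(* The i-th term is the sum over u of the S(- deg i u); as modules are
   N^n-graded, no negative shift is needed. *)
Record gr_free_cplx M := GrFreeCplx {
  gr_cplx :> free_cplx M;
  deg : forall i, 'I_(rank gr_cplx i) -> nat }.

Definition is_graded M (F : gr_free_cplx M) : Prop :=
  (forall v, totcomp (deg v) (aug F (delta_mx 0 v))) /\
  (forall i (u : 'I_(rank F i.+1)) (v : 'I_(rank F i)),
    dif F i u v = 0 \/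
    (deg v <= deg u)%N /\ dif F i u v \is (deg u - deg v).-homog).

Definition is_min_gr_free_resolution M (F : gr_free_cplx M) : Prop :=
  [/\ is_free_resolution F, is_graded F & is_minimal F].

(* The number of generators of degree [k] in the [j]-th term of a minimal
   graded free resolution. *)
Definition betti M (j k : int) : nat :=
  match j with
  | Posz j =>
    if pselect (exists F : gr_free_cplx M, is_min_gr_free_resolution F)
      is left ex
    then let F := projT1 (cid ex) in
      #|[set v : 'I_(rank F j) | (deg v)%:Z == k]|
    else 0%N
  | Negz _ => 0%N
  end.

Definition reg M : eint :=
  esup (fun r => exists j k : int, betti M j k <> 0%N /\ r = efin (k - j)).

End Betti.

(** * Projective dimension *)

Section ProjectiveDimension.
Variable R : nzRingType.

Definition projective (P : lmodType R) : Prop :=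
  forall (A B : lmodType R) (g : {linear A -> B}) (f : {linear P -> B}),
    (forall b, exists a, g a = b) ->
    exists h : {linear P -> A}, forall x, g (h x) = f x.

Record proj_cplx (N : lmodType R) := ProjCplx {
  pterm : nat -> lmodType R;
  pdif : forall i, {linear pterm i.+1 -> pterm i};
  paug : {linear pterm 0 -> N} }.

Definition is_proj_resolution (N : lmodType R) (P : proj_cplx N) : Prop :=
  [/\ forall i, projective (pterm P i),
      forall x, exists y, paug P y = x,
      forall y, paug P y = 0 <-> exists z, y = pdif P 0 z
    & forall i y, pdif P i y = 0 <-> exists z, y = pdif P i.+1 z].

(* the largest [i] with P_i <> 0 *)
Definition plength (N : lmodType R) (P : proj_cplx N) : eint :=
  esup (fun r => exists i : nat,
    (exists x : pterm P i, x <> 0) /\ r = efin i%:Z).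

(* -oo for the zero module *)
Definition projdim (N : lmodType R) : eint :=
  einf (fun r => exists P : proj_cplx N,
    is_proj_resolution P /\ r = plength P).

End ProjectiveDimension.

(** * Multigraded free modules and their homomorphisms *)

Section MultigradedFree.
Variables (K : fieldType) (n : nat).

(* the sum over u of the S(- shift u) *)
Record mgfree := MgFree {
  mgrank : nat;
  shift : 'I_mgrank -> 'X_{1..n} }.

(* the map with components f |-> coef u v * x^(a_u - b_v) * f *)
Record mghom (F G : mgfree) := MgHom {
  coef : 'M[K]_(mgrank F, mgrank G);
  coef_eq0 : forall u v, ~~ (shift v <= shift u)%MM -> coef u v = 0 }.

Definition mghom_mx (F G : mgfree) (phi : mghom F G) :
    'M[{mpoly K[n]}]_(mgrank F, mgrank G) :=
  \matrix_(u, v) (coef phi u v *: 'X_[(shift u - shift v)%MM]).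

Variable M : grmod K n.

Definition mgaug_homog (F : mgfree)
    (a : {linear 'rV[{mpoly K[n]}]_(mgrank F) -> M}) : Prop :=
  forall v, mgcomp (shift v) (a (delta_mx 0 v)).

Definition is_mgpresentation (F1 F0 : mgfree) (phi : mghom F1 F0)
    (a : {linear 'rV[{mpoly K[n]}]_(mgrank F0) -> M}) : Prop :=
  [/\ mgaug_homog a,
      forall x, exists c, a c = x
    & forall c, a c = 0 <-> exists b, c = b *m mghom_mx phi].

Record mgcplx := MgCplx {
  mgterm : nat -> mgfree;
  mgdif : forall i, mghom (mgterm i.+1) (mgterm i);
  mgaug : {linear 'rV[{mpoly K[n]}]_(mgrank (mgterm 0)) -> M} }.

Definition mgcplx_free (F : mgcplx) : free_cplx M :=
  @FreeCplx _ M (fun i => mgrank (mgterm F i)) (fun i => mghom_mx (mgdif F i))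
    (mgaug F).

Definition is_min_mgresolution (F : mgcplx) : Prop :=
  [/\ is_free_resolution (mgcplx_free F), mgaug_homog (mgaug F)
    & is_minimal (mgcplx_free F)].

End MultigradedFree.

(** * Cokernels *)

Section Coker.
Variables (R : nzRingType) (U V : lmodType R) (f : {linear U -> V}).

Definition im_pred : {pred V} := fun v => `[< exists u, f u = v >].

Lemma im_pred_submod : submod_closed im_pred.
Proof.
split=> [|c _ _ /asboolP[u <-] /asboolP[w <-]]; apply/asboolP.
  by exists 0; rewrite linear0.
by exists (c *: u + w); rewrite linearP.
Qed.

HB.instance Definition _ := GRing.isSubmodClosed.Build R V im_pred
  im_pred_submod.

Definition coker : Type := Quotient.quot im_pred.
HB.instance Definition _ := GRing.Zmodule.on coker.

Definition coker_pi (v : V) : coker := \pi_(Quotient.quot im_pred)%qT v.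

Lemma coker_piP v w : coker_pi v = coker_pi w <-> exists u, f u = v - w.
Proof.
rewrite /coker_pi; split=> [/eqP|h].
  by rewrite -Quotient.idealrBE => /asboolP.
by apply/eqP; rewrite -Quotient.idealrBE; apply/asboolP.
Qed.

Lemma coker_piB : {morph coker_pi : v w / v - w}.
Proof. by move=> v w; rewrite /coker_pi raddfB. Qed.

Lemma coker_piD : {morph coker_pi : v w / v + w}.
Proof. by move=> v w; rewrite /coker_pi raddfD. Qed.

Definition coker_repr (y : coker) : V := repr (y : Quotient.quot im_pred).

Lemma coker_reprK : cancel coker_repr coker_pi.
Proof. by move=> y; rewrite /coker_repr /coker_pi reprK. Qed.

Definition coker_scale (c : R) (y : coker) : coker :=
  coker_pi (c *: coker_repr y).

Lemma coker_piZ c v : coker_pi (c *: v) = coker_scale c (coker_pi v).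
Proof.
apply/coker_piP.
have [u fu] : exists u, f u = v - coker_repr (coker_pi v).
  by apply/coker_piP; rewrite coker_reprK.
by exists (c *: u); rewrite linearZ /= fu scalerBr.
Qed.

Lemma coker_scaleA a b y :
  coker_scale a (coker_scale b y) = coker_scale (a * b) y.
Proof. by rewrite -[y]coker_reprK -!coker_piZ scalerA. Qed.

Lemma coker_scale1 : left_id 1 coker_scale.
Proof. by move=> y; rewrite -[y]coker_reprK -!coker_piZ scale1r. Qed.

Lemma coker_scaleDr : right_distributive coker_scale +%R.
Proof.
move=> a x y; rewrite -[x]coker_reprK -[y]coker_reprK.
by rewrite -coker_piD -!coker_piZ -coker_piD scalerDr.
Qed.

Lemma coker_scaleDl y : {morph coker_scale^~ y : a b / a + b}.
Proof.
move=> a b; rewrite -[y]coker_reprK -!coker_piZ -coker_piD.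
by rewrite scalerDl.
Qed.

HB.instance Definition _ := GRing.Zmodule_isLmodule.Build R coker
  coker_scaleA coker_scale1 coker_scaleDr coker_scaleDl.

End Coker.

(** * The expansion functor with respect to (e_1, ..., e_n) *)

Section Expansion.
Variables (K : fieldType) (n : nat) (e : 'I_n -> nat).

(* The variables x_jk of S^* are numbered by the canonical enumeration of
   the pairs (j, k). *)
Definition nvars : nat := #|{: {j : 'I_n & 'I_(e j)}}|.
Local Notation Sstar := {mpoly K[nvars]}.

Definition xvar (j : 'I_n) (k : 'I_(e j)) : Sstar :=
  'X_(enum_rank (Tagged (fun j => 'I_(e j)) k)).

Definition primeP (j : 'I_n) : Sstar -> Prop :=
  ideal_gen (fun f => exists k, f = @xvar j k).

Definition star_ideal (a : 'X_{1..n}) : Sstar -> Prop :=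
  \big[@ideal_mul Sstar/@ideal_one Sstar]_(j < n) ideal_exp (primeP j) (a j).

Lemma star_ideal_ideal a : is_ideal (star_ideal a).
Proof.
rewrite /star_ideal; elim/big_ind: _ => [//|I J _ _|j _].
  exact: ideal_gen_ideal.
exact: ideal_exp_ideal.
Qed.

Lemma star_ideal_sub a b : (b <= a)%MM ->
  forall f, star_ideal a f -> star_ideal b f.
Proof.
move=> /mnm_lepP leba; rewrite /star_ideal.
elim/big_ind2: _ => [//|I I' J J' sI sJ|j _].
  exact: ideal_mul_mono.
exact: ideal_exp_mono.
Qed.

Definition star_pred (F : mgfree n) : {pred 'rV[Sstar]_(mgrank F)} :=
  fun v => `[< forall u, star_ideal (shift u) (v 0 u) >].

Arguments star_pred : clear implicits.

Lemma star_pred_submod F : submod_closed (star_pred F).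
Proof.
split=> [|c x y /asboolP xF /asboolP yF]; apply/asboolP => u; rewrite !mxE.
  by case: (star_ideal_ideal (shift u)).
by case: (star_ideal_ideal (shift u)) => _; apply.
Qed.

HB.instance Definition _ F := GRing.isSubmodClosed.Build Sstar _ (star_pred F)
  (star_pred_submod F).

Definition starmod (F : mgfree n) : Type := {v | v \in star_pred F}.
HB.instance Definition _ F := SubChoice.on (starmod F).
HB.instance Definition _ F :=
  [SubChoice_isSubLmodule of starmod F by <:].

(* F^*, with the multigrading inherited from S^* *)
Definition star_free (F : mgfree n) : grmod K nvars :=
  @GrMod K nvars (starmod F)
    (fun c v => forall u, exists l : K, val v 0 u = l *: 'X_[c]).

Section StarMap.
Variables (F G : mgfree n) (phi : mghom K F G).

Definition star_mx : 'M[Sstar]_(mgrank F, mgrank G) :=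
  map_mx (@mpolyC nvars K) (coef phi).

Lemma star_map_subproof (x : starmod F) : val x *m star_mx \in star_pred G.
Proof.
apply/asboolP => v; rewrite mxE.
have [I0 Icl] := star_ideal_ideal (shift v).
elim/big_ind: _ => // [f g If Ig|u _]; first by rewrite -[f]mul1r; apply: Icl.
rewrite mxE mulrC; case: (boolP (shift v <= shift u)%MM) => le_vu; last first.
  by rewrite coef_eq0 // mpolyC0 mul0r.
rewrite -[_ * _]addr0; apply: Icl => //; apply: star_ideal_sub le_vu _ _.
by have /asboolP := valP x; apply.
Qed.

(* phi^* *)
Definition star_map (x : starmod F) : starmod G :=
  exist _ (val x *m star_mx) (star_map_subproof x).

Lemma star_map_linear : linear star_map.
Proof.
by move=> c x y; apply: val_inj; rewrite /= mulmxDl -scalemxAl.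
Qed.

HB.instance Definition _ := GRing.isLinear.Build Sstar (starmod F) (starmod G)
  _ star_map star_map_linear.

(* Coker phi^* *)
Definition expansion : grmod K nvars :=
  @GrMod K nvars (coker star_map)
    (fun c y => exists2 v : star_free G, mgcomp c v & y = coker_pi star_map v).

End StarMap.

End Expansion.

(* Main.v *)
Require Import Defs.
From HB Require Import structures.
From mathcomp Require Import all_boot all_order all_algebra.
From mathcomp Require Import boolp.
From mathcomp Require Import mpoly.
From mathcomp Require Import -(notations) constructive_ereal.
Set Implicit Arguments.
Unset Strict Implicit.
Unset Printing Implicit Defensive.
Import Order.TTheory GRing.Theory Num.Theory.
Local Open Scope ring_scope.

(* The expansion functor is exact: the component of multidegree [c] of F^* is
   the component of multidegree [collapse c] of F, with the same scalar
   matrices.  So M^* is resolved by the complex of the F_i^*, and it remains to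
   resolve the ideals (x^a)^* compatibly with the inclusions between them.  This
   is done by splitting one new variable y off a variable x at a time: (x, y)^a
   has the Hilbert-Burch resolution with generators g_i = x^(a-i) y^i and
   syzygies s_t : g_(t+1) - g_t, which is strictly functorial in a through
   g_i |-> g_min(i, a').  The total complex of the resulting double complex is a
   free resolution; it is minimal because its horizontal maps strictly lower
   |a|, and its generators over a summand S(-a) of F_i depend only on a.  Those
   in homological degree i + t have degree |a| + t, and t reaches
   sum_(k in supp a) (i_k - 1).  Exactness is checked multidegree by multidegree,
   where everything is linear algebra over K. *)

(** * Suprema and projective lifting *)

(** The obstacle is strictness. If the ideals were resolved one by one and the inclusions lifted by
    projectivity, the squares would commute only up to homotopy, and a total complex would call for
    higher homotopies. For a single pair (x, y) the lifts compose on the nose, and the splitting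
    applies to any complex whose shifts avoid y; hence the iteration, rather than a resolution of a
    power of P_j at one stroke. In a fixed multidegree c, the generators that survive over a given a
    are those with a - c(x) <= i <= min(a, c(y)) and 0 <= i, and the syzygies join neighbours: a
    path, contractible onto an end. It has to be the last vertex, since capping at c(y) commutes
    with capping at a', whereas the first vertices are not respected by the horizontal maps. Each
    F_i^* is the case of a complex concentrated in degree 0, so both sides of the Betti formula
    count one and the same basis. Finally, [betti] picks an unspecified graded resolution and
    [projdim] ranges over all projective ones. Both are compared with the constructed resolution
    modulo the maximal ideal. *)

Lemma esup_eq A u : is_esup A u -> esup A = u.
Proof.
move=> [ubu lubu]; rewrite /esup; case: pselect => [ex|[]]; last by exists u.
case: (cid ex) => /= w [ubw lubw].
by apply/le_anti/andP; split; [exact: lubw | exact: lubu].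
Qed.

Lemma einf_eq A u : is_einf A u -> einf A = u.
Proof.
move=> [lbu glbu]; rewrite /einf; case: pselect => [ex|[]]; last by exists u.
case: (cid ex) => /= w [lbw glbw].
by apply/le_anti/andP; split; [exact: glbu | exact: glbw].
Qed.

Lemma nat_bounded_max (A : nat -> Prop) (d : nat) :
    (exists i, A i) -> (forall i, A i -> (i <= d)%N) ->
  exists2 m, A m & forall i, A i -> (i <= m)%N.
Proof.
move=> [i0 Ai0] bd.
have exA : exists i, `[< A i >] by exists i0; apply/asboolP.
have ubA i : `[< A i >] -> (i <= d)%N by move=> /asboolP /bd.
case: (ex_maxnP exA ubA) => m /asboolP Am max_m; exists m => // i Ai.
by apply: max_m; apply/asboolP.
Qed.

Lemma is_esup_nat (A : nat -> Prop) :
  exists u, is_esup (fun r => exists i : nat, A i /\ r = efin i%:Z) u.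
Proof.
have [[i0 Ai0]|noA] := pselect (exists i, A i); last first.
  exists eNoo; split=> [x [i [Ai _]]|w _]; first by case: noA; exists i.
  exact: leNye.
have [[d bd]|unbd] := pselect (exists d, forall i, A i -> (i <= d)%N).
  have [m Am max_m] := nat_bounded_max (ex_intro _ _ Ai0) bd.
  exists (efin m%:Z); split=> [_ [i [/max_m im ->]]|w ubw].
    by rewrite lee_fin lez_nat.
  by apply: ubw; exists m.
exists (@EPInf int); split=> [x _|w ubw]; first exact: leey.
case: w ubw => [z| |] ubw //.
- case: unbd; exists `|z|%N => i Ai.
  have : (efin i%:Z <= efin z)%O by apply: ubw; exists i.
  by rewrite lee_fin -lez_nat => /le_trans; apply; rewrite abszE ler_norm.
- have : (efin i0%:Z <= eNoo)%O by apply: ubw; exists i0.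
  by [].
Qed.

Section ProjectiveLifting.
Variable R : nzRingType.
Implicit Types A B P : lmodType R.

Definition image A B (g : {linear A -> B}) : Type := {v | v \in im_pred g}.
HB.instance Definition _ A B (g : {linear A -> B}) := SubChoice.on (image g).
HB.instance Definition _ A B (g : {linear A -> B}) :=
  [SubChoice_isSubLmodule of image g by <:].

(** [projective] speaks of surjections only, so both maps are first corestricted to the image of
    [g]. *)
Lemma projective_lift A B P (g : {linear A -> B}) (f : {linear P -> B}) :
    projective P -> (forall x, exists a, g a = f x) ->
  exists h : {linear P -> A}, forall x, g (h x) = f x.
Proof.
move=> projP fg.
have gP a : g a \in im_pred g by apply/asboolP; exists a.
have fP x : f x \in im_pred g by apply/asboolP.
pose g0 a : image g := exist _ (g a) (gP a).
pose f0 x : image g := exist _ (f x) (fP x).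
have g0L : linear g0 by move=> c x y; apply: val_inj; rewrite /= linearP.
have f0L : linear f0 by move=> c x y; apply: val_inj; rewrite /= linearP.
pose g1 : {linear A -> image g} :=
  HB.pack g0 (GRing.isLinear.Build _ _ _ _ g0 g0L).
pose f1 : {linear P -> image g} :=
  HB.pack f0 (GRing.isLinear.Build _ _ _ _ f0 f0L).
have [|h hE] := projP _ _ g1 f1.
  by case=> v vP; case/asboolP: (vP) => a ga; exists a; apply: val_inj.
by exists h => x; have /(congr1 val) := hE x.
Qed.

Lemma projective_rV r : projective 'rV[R]_r.
Proof.
move=> A B g f gs.
pose a i := projT1 (cid (gs (f (delta_mx 0 i)))).
have aE i : g (a i) = f (delta_mx 0 i) by rewrite /a; case: (cid _).
pose h (x : 'rV[R]_r) := \sum_i x 0 i *: a i.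
have hL : linear h.
  move=> c x y; rewrite /h scaler_sumr -big_split; apply: eq_bigr => i _ /=.
  by rewrite !mxE scalerDl scalerA.
pose h1 : {linear 'rV[R]_r -> A} :=
  HB.pack h (GRing.isLinear.Build _ _ _ _ h hL).
exists h1 => x; rewrite /= /h linear_sum [in RHS](row_sum_delta x) linear_sum.
by apply: eq_bigr => i _; rewrite !linearZ /= aE.
Qed.

Section Chains.
Variables (X Y : nat -> lmodType R).
Variable (dX : forall i, {linear X i.+1 -> X i}).
Variable (dY : forall i, {linear Y i.+1 -> Y i}).
Hypothesis projX : forall i, projective (X i.+1).
Hypothesis dXX : forall i x, dX i (dX i.+1 x) = 0.
Hypothesis exY : forall i y, dY i y = 0 -> exists z, dY i.+1 z = y.

Lemma chain_lift (f0 : {linear X 0 -> Y 0}) :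
    (forall y, exists z, dY 0 z = y) ->
  exists f : forall i, {linear X i -> Y i},
    (forall x, f 0%N x = f0 x) /\
    forall i x, dY i (f i.+1 x) = f i (dX i x).
Proof.
move=> surjY.
(* A stage holds two consecutive components together with the square between them: exactly what the
   choice of the next component depends on. *)
pose st i := {p : {linear X i -> Y i} * {linear X i.+1 -> Y i.+1} |
  forall x, dY i (p.2 x) = p.1 (dX i x)}.
have next i (p : st i) :
    {g : {linear X i.+2 -> Y i.+2} |
      forall x, dY i.+1 (g x) = (projT1 p).2 (dX i.+1 x)}.
  apply: cid; case: p => -[f g] /= fgE.
  have [|h hE] := @projective_lift _ _ _ (dY i.+1) (g \o dX i.+1) (@projX i.+1).
    by move=> x /=; apply: exY; rewrite fgE dXX linear0.
  by exists h.
have first : {g : {linear X 1 -> Y 1} | forall x, dY 0 (g x) = f0 (dX 0 x)}.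
  apply: cid.
  have [|h hE] := @projective_lift _ _ _ (dY 0) (f0 \o dX 0%N) (@projX 0).
    by move=> x /=.
  by exists h.
pose fix s i : st i := match i with
  | 0 => exist _ (f0, projT1 first) (projT2 first)
  | j.+1 => let g := next j (s j) in
            exist _ ((projT1 (s j)).2, projT1 g) (projT2 g)
  end.
exists (fun i => (projT1 (s i)).1); split=> // i x.
by rewrite -(projT2 (s i)).
Qed.

Lemma chain_homotopy (k : forall i, {linear X i -> Y i}) :
    (forall x, k 0%N x = 0) ->
    (forall i x, dY i (k i.+1 x) = k i (dX i x)) ->
  exists h : forall i, {linear X i -> Y i.+1},
    (forall x, h 0%N x = 0) /\
    forall i x, k i.+1 x = dY i.+1 (h i.+1 x) + h i (dX i x).
Proof.
move=> k0 kE.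
(* The invariant is the homotopy identity in degree [i] on boundaries, where the term involving the
   previous homotopy vanishes because [dX] squares to zero. *)
pose st i := {h : {linear X i -> Y i.+1} |
  forall x, dY i (h (dX i x)) = k i (dX i x)}.
have next i (p : st i) :
    {g : {linear X i.+1 -> Y i.+2} |
      forall x, k i.+1 x = dY i.+1 (g x) + projT1 p (dX i x)}.
  apply: cid; case: p => h /= hE.
  pose u : {linear X i.+1 -> Y i.+1} := k i.+1 \- (h \o dX i).
  have [|g gE] := @projective_lift _ _ _ (dY i.+1) u (@projX i).
    by move=> x; apply: exY; rewrite /u /= linearB /= hE kE subrr.
  by exists g => x; rewrite gE /u /= subrK.
have nextP i (p : st i) x :
    dY i.+1 (projT1 (next i p) (dX i.+1 x)) = k i.+1 (dX i.+1 x).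
  by rewrite (projT2 (next i p)) dXX linear0 addr0.
have firstP x : dY 0%N ((\0 : {linear X 0 -> Y 1}) (dX 0%N x)) = k 0%N (dX 0%N x).
  by rewrite /= linear0 k0.
pose fix s i : st i := match i with
  | 0 => exist _ (\0 : {linear X 0 -> Y 1}) firstP
  | j.+1 => exist _ (projT1 (next j (s j))) (nextP j (s j))
  end.
by exists (fun i => projT1 (s i)); split=> // i x; rewrite (projT2 (next i (s i))).
Qed.

End Chains.
End ProjectiveLifting.

(** * Minimal resolutions *)

(** The resolved module sits at index 0, so that lifting over the augmentation and over the
    differentials is one induction; projectivity is asked from index 1 on. *)
Definition augterm (R : nzRingType) (N : lmodType R) (T : nat -> lmodType R)
    (i : nat) : lmodType R :=
  if i is j.+1 then T j else N.

Definition paugdif (R : nzRingType) (N : lmodType R) (P : proj_cplx N) i :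
    {linear augterm N (pterm P) i.+1 -> augterm N (pterm P) i} :=
  match i with 0 => paug P | j.+1 => pdif P j end.

Section AugmentedComplexes.
Variables (K : fieldType) (n : nat).
Local Notation S := {mpoly K[n]}.

Definition fterm (N : lmodType S) (F : free_cplx N) (i : nat) : lmodType S :=
  'rV[S]_(rank F i).

Definition augdif (N : lmodType S) (F : free_cplx N) i :
    {linear augterm N (fterm F) i.+1 -> augterm N (fterm F) i} :=
  match i with
  | 0 => aug F
  | j.+1 => mulmxr (dif F j) : {linear 'rV_(rank F j.+1) -> 'rV_(rank F j)}
  end.

Lemma proj_resolution_exact (N : lmodType S) (P : proj_cplx N) :
    is_proj_resolution P ->
  [/\ forall i, projective (augterm N (pterm P) i.+1),
      forall y, exists z, paugdif P 0 z = y,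
      forall i x, paugdif P i (paugdif P i.+1 x) = 0
    & forall i y, paugdif P i y = 0 -> exists z, paugdif P i.+1 z = y].
Proof.
move=> [projP sP e0 eS]; split=> //.
- case=> [|i] x /=; first by apply/e0; exists x.
  by apply/eS; exists x.
- by case=> [|i] y /= => [/e0|/eS] [z ->]; exists z.
Qed.

Lemma free_resolution_exact (N : lmodType S) (F : free_cplx N) :
    is_free_resolution F ->
  [/\ forall i, projective (augterm N (fterm F) i.+1),
      forall y, exists z, augdif F 0 z = y,
      forall i x, augdif F i (augdif F i.+1 x) = 0
    & forall i y, augdif F i y = 0 -> exists z, augdif F i.+1 z = y].
Proof.
move=> [sF e0 eS]; split=> //.
- by move=> i; apply: projective_rV.
- case=> [|i] x /=; first by apply/e0; exists x.
  by apply/eS; exists x.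
- by case=> [|i] y /= => [/e0|/eS] [z ->]; exists z.
Qed.

Lemma maxideal_const (f : S) : maxideal f -> f@_0%MM = 0.
Proof.
case=> s [sG ->]; rewrite raddf_sum big_seq big1 //= => cg /sG[i ->].
by rewrite rmorphM /= mcoeffX mnm1_eq0 mulr0.
Qed.

Lemma maxideal_mpolyX (c : K) (m : 'X_{1..n}) :
  m != 0%MM -> maxideal (c *: 'X_[m] : S).
Proof.
move=> m0; have [i mi] : exists i, m i != 0%N.
  apply/existsP; rewrite -negb_forall; apply: contra m0 => /forallP m0.
  by apply/eqP/mnmP => i; rewrite mnmE; apply/eqP.
have -> : m = (m - U_(i) + U_(i))%MM by rewrite submK ?lep1mP.
rewrite mpolyXD scalerAl; exists [:: (c *: 'X_[m - U_(i)], 'X_i)].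
by rewrite big_seq1; split=> // cg; rewrite inE => /eqP->; exists i.
Qed.

(* A chain endomorphism lifting the identity is homotopic to it, and on a
   minimal resolution a homotopy vanishes modulo (x_1, ..., x_n). *)
Lemma minimal_endo_const (M : grmod K n) (F : free_cplx M)
    (k : forall i, {linear augterm M (fterm F) i -> augterm M (fterm F) i}) :
    is_free_resolution F -> is_minimal F ->
    (forall x, k 0%N x = x) ->
    (forall i x, augdif F i (k i.+1 x) = k i (augdif F i x)) ->
  forall j (u v : 'I_(rank F j)),
    ((k j.+1 (delta_mx 0 u) : 'rV_(rank F j)) 0 v)@_0%MM = (u == v)%:R.
Proof.
move=> resF minF k0 kE j u v.
have [projF surjF dd exF] := free_resolution_exact resF.
pose k' i : {linear augterm M (fterm F) i -> augterm M (fterm F) i} :=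
  k i \- idfun.
have k'0 x : k' 0%N x = 0 by rewrite /k' /= k0 subrr.
have k'E i x : augdif F i (k' i.+1 x) = k' i (augdif F i x).
  by rewrite /k' /= linearB kE.
have [h [h0 hE]] := chain_homotopy projF dd exF k'0 k'E.
pose a : 'rV_(rank F j) := augdif F j.+1 (h j.+1 (delta_mx 0 u)).
pose b : 'rV_(rank F j) := h j (augdif F j (delta_mx 0 u)).
have kab : k j.+1 (delta_mx 0 u) = a + b + delta_mx 0 u :> 'rV_(rank F j).
  by apply/eqP; rewrite -subr_eq; apply/eqP/hE.
suff [a0 b0] : (a 0 v)@_0%MM = 0 /\ (b 0 v)@_0%MM = 0.
  rewrite kab mxE [X in (X + _)@_0]mxE !raddfD /= a0 b0 !add0r mxE eqxx /= eq_sym; case: eqP => _.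
    by rewrite mcoeff1 eqxx.
  by rewrite mcoeff0.
split.
  rewrite /a /= mxE raddf_sum big1 //= => w _.
  by rewrite rmorphM /= [X in _ * X]maxideal_const ?mulr0.
rewrite /b {a b kab k' k'0 k'E hE k k0 kE}.
case: j u v => [|j] u v; first by rewrite h0 mxE mcoeff0.
rewrite /= -rowE.
set r := row u _; rewrite (row_sum_delta r) linear_sum /= summxE raddf_sum.
rewrite big1 //= => w _; rewrite linearZ mxE rmorphM /= [r 0 w]mxE.
by rewrite maxideal_const ?mul0r.
Qed.

(** The composite F -> P -> F has constant part the identity, yet in degree [j] it passes through
    P_j = 0; a generator of F_j would give 1 = 0 in [K]. *)
Lemma minimal_rank0 (M : grmod K n) (F : free_cplx M) (P : proj_cplx M) j :
    is_free_resolution F -> is_minimal F -> is_proj_resolution P ->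
    (forall x : pterm P j, x = 0) ->
  rank F j = 0%N.
Proof.
move=> resF minF resP P0.
have [pF sF ddF exF] := free_resolution_exact resF.
have [pP sP ddP exP] := proj_resolution_exact resP.
have [f [f0 fE]] := chain_lift pF ddF exP (idfun : {linear M -> M}) sP.
have [g [g0 gE]] := chain_lift pP ddP exF (idfun : {linear M -> M}) sF.
case rFj: (rank F j) => [//|r]; exfalso.
have u : 'I_(rank F j) by rewrite rFj; exact: ord0.
pose k i : {linear augterm M (fterm F) i -> augterm M (fterm F) i} :=
  g i \o f i.
have k0 x : k 0%N x = x by rewrite /k /= f0 g0.
have kE i x : augdif F i (k i.+1 x) = k i (augdif F i x).
  by rewrite /k /= gE fE.
have := minimal_endo_const resF minF k0 kE u u.
by rewrite /k /= (P0 (f j.+1 _)) linear0 mxE mcoeff0 eqxx => /eqP; rewrite eq_sym oner_eq0.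
Qed.

Definition free_proj (N : lmodType S) (F : free_cplx N) : proj_cplx N :=
  @ProjCplx _ N (fterm F) (fun i => augdif F i.+1) (augdif F 0).

Lemma free_proj_resolution (N : lmodType S) (F : free_cplx N) :
  is_free_resolution F -> is_proj_resolution (free_proj F).
Proof.
move=> resF; have [pF sF ddF exF] := free_resolution_exact resF.
split=> [i|//|y|i y]; first exact: (pF i).
  split=> [/(exF 0)[z <-]|[z ->]]; [by exists z | exact: (ddF 0)].
by split=> [/(exF i.+1)[z <-]|[z ->]]; [exists z | exact: (ddF i.+1)].
Qed.

(** By [minimal_rank0], a nonzero term of [F] forces a nonzero term in the same degree of every
    projective resolution; so [F], being one of them, attains the infimum. *)
Lemma projdim_minimal (M : grmod K n) (F : free_cplx M) :
    is_free_resolution F -> is_minimal F ->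
  projdim M = esup (fun r => exists i : nat, rank F i <> 0%N /\ r = efin i%:Z).
Proof.
move=> resF minF; have [u uP] := is_esup_nat (fun i => rank F i <> 0%N).
rewrite (esup_eq uP); apply: einf_eq; split=> [_ [P [resP ->]]|w lbw].
  have [v vP] := is_esup_nat (fun i => exists x : pterm P i, x <> 0).
  rewrite /plength (esup_eq vP); apply: uP.2 => _ [i [rFi ->]]; apply: vP.1.
  exists i; split=> //; apply: contra_notP rFi => noP.
  by apply: (minimal_rank0 resF minF resP) => x; apply: contra_notP noP; exists x.
apply: lbw; exists (free_proj F); split; first exact: free_proj_resolution.
rewrite /plength -(esup_eq uP); congr esup; apply/funext => r; apply/propext.
have rank_neq0 i : rank F i <> 0%N <-> exists x : 'rV[S]_(rank F i), x <> 0.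
  split=> [|[x x0] ri]; last first.
    apply: x0; apply/rowP => v; have := ltn_ord v.
    by rewrite [X in (_ < X)%N]ri.
  case: (rank F i) => // r0 _; exists (delta_mx 0 ord0) => /rowP /(_ ord0).
  by rewrite !mxE !eqxx => /eqP; rewrite oner_eq0.
by split=> -[i [/rank_neq0 ri ->]]; exists i.
Qed.

End AugmentedComplexes.

(** * Homogeneous components of shifted polynomial rings *)

Section HomogeneousParts.
Variables (K : fieldType) (n : nat).
Local Notation S := {mpoly K[n]}.
Implicit Types (p q : S) (D E d : nat).

(* the component of degree [D] in S(-d) *)
Definition hpart D d p : S := if (d <= D)%N then pihomog mdeg (D - d) p else 0.

(** Zero is listed apart because [D - d] is truncated: for [d > D] it is the only element of degree
    [D] in S(-d). *)
Definition homog_in D d p : Prop :=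
  p = 0 \/ (d <= D)%N /\ p \is (D - d).-homog.

Lemma hpartB D d : {morph hpart D d : p q / p - q}.
Proof. by move=> p q; rewrite /hpart; case: ifP => _; rewrite ?raddfB ?subr0. Qed.

Lemma hpart_sum D d (I : Type) (r : seq I) (f : I -> S) :
  hpart D d (\sum_(i <- r) f i) = \sum_(i <- r) hpart D d (f i).
Proof.
by rewrite /hpart; case: ifP => _; [rewrite raddf_sum | rewrite big1_eq].
Qed.

Lemma hpart_homog D d p : homog_in D d (hpart D d p).
Proof.
by rewrite /hpart; case: ifP => le_dD; [right; split=> //; exact: pihomogP | left].
Qed.

Lemma hpart_id D d p : homog_in D d p -> hpart D d p = p.
Proof.
by rewrite /hpart => -[->|[-> /pihomog_dE //]]; rewrite raddf0 if_same.
Qed.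

Lemma hpart_neq D E d p : D != E -> homog_in E d p -> hpart D d p = 0.
Proof.
rewrite /hpart => neDE [->|[le_dE hp]]; first by rewrite raddf0 if_same.
case: leqP => // le_dD; apply: pihomog_ne0 hp.
by apply: contra neDE => /eqP eqDE; rewrite -(subnK le_dE) eqDE subnK.
Qed.

Lemma hpart_partition d p D0 :
  (msize p + d <= D0)%N -> p = \sum_(D < D0) hpart D d p.
Proof.
move=> le_D0; have le_dD : (d <= D0)%N by apply: leq_trans le_D0; apply: leq_addl.
rewrite -(big_mkord xpredT (fun D => hpart D d p)) (big_cat_nat (n := d)) //=.
rewrite big_nat big1 ?add0r => [|D /andP[_ ltDd]]; last first.
  by rewrite /hpart leqNgt ltDd.
rewrite -{1}[d]add0n big_addn big_mkord.
have le_p : (mmeasure mdeg p <= D0 - d)%N by rewrite leq_subRL // addnC.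
apply: etrans (pihomog_partitionE le_p) _; apply: eq_bigr => D _.
by rewrite /hpart leq_addl addnK.
Qed.

Lemma homog_inM D E d p q :
  homog_in D E p -> homog_in E d q -> homog_in D d (p * q).
Proof.
move=> [->|[ED hp]]; first by rewrite mul0r; left.
move=> [->|[dE hq]]; first by rewrite mulr0; left.
right; split; first exact: leq_trans ED.
have -> : (D - d = (D - E) + (E - d))%N.
  by rewrite addnBA // subnK.
exact: dhomogM.
Qed.

(** Multiplication by [q] is a degree-preserving map S(-E) -> S(-d), hence commutes with taking
    components of degree [D]. *)
Lemma hpartMr D E d p q :
  homog_in E d q -> hpart D d (p * q) = hpart D E p * q.
Proof.
move=> hq; rewrite {1}(hpart_partition (leqnn (msize p + E))) mulr_suml hpart_sum.
have [ltD|leD] := ltnP D (msize p + E).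
  rewrite (bigD1 (Ordinal ltD)) //= big1 ?addr0.
    by rewrite hpart_id //; apply: homog_inM hq; apply: hpart_homog.
  move=> i neqi; apply: (@hpart_neq _ i).
    by apply: contra neqi => /eqP eqDi; apply/eqP/val_inj; rewrite /= eqDi.
  by apply: homog_inM hq; apply: hpart_homog.
rewrite big1 => [|i _].
  have -> : hpart D E p = 0; last by rewrite mul0r.
  have EP := hpart_partition (leqnn (msize p + E)).
  rewrite [in LHS]EP hpart_sum big1 // => i _.
  apply: (@hpart_neq _ i); last exact: hpart_homog.
  by rewrite gtn_eqF // (leq_trans _ leD).
apply: (@hpart_neq _ i); first by rewrite gtn_eqF // (leq_trans _ leD).
by apply: homog_inM hq; apply: hpart_homog.
Qed.

(** Here [q] is an element of degree [D] of S(-E), and [hpart E d p] is the degree-preserving part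
    of multiplication by [p], seen as a map S(-E) -> S(-d). *)
Lemma hpartMl D E d p q :
  homog_in D E q -> hpart D d (q * p) = q * hpart E d p.
Proof.
move=> [->|[leED hq]].
  by rewrite !mul0r hpart_id //; left.
rewrite {1}(hpart_partition (leqnn (msize p + d))) mulr_sumr hpart_sum.
rewrite [in RHS](hpart_partition (leqnn (msize p + d))) hpart_sum mulr_sumr.
have homqp i x : homog_in i d x -> homog_in (D - E + i) d (q * x).
  move=> [->|[ledi hx]]; first by rewrite mulr0; left.
  right; split; first exact: leq_trans (leq_addl _ _).
  by rewrite -addnBA //; apply: dhomogM.
apply: eq_bigr => i _; have hx := hpart_homog i d p; have [eqEi|neqi] := eqVneq E i.
  have hqx := homqp _ _ hx.
  by rewrite eqEi [in RHS]hpart_id // hpart_id // -{1}(subnK leED) {2}eqEi.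
rewrite (@hpart_neq D (D - E + i)) ?(hpart_neq neqi) ?mulr0 //; last exact: homqp.
by apply: contra neqi; rewrite -{1}(subnK leED) eqn_add2l.
Qed.

End HomogeneousParts.

(** * Independence of graded Betti numbers from the minimal resolution *)

Section BettiUniqueness.
Variables (K : fieldType) (n : nat).
Local Notation S := {mpoly K[n]}.

Definition hrow r (dg : 'I_r -> nat) D (c : 'rV[S]_r) : 'rV[S]_r :=
  \row_v hpart D (dg v) (c 0 v).

Definition hmx r' r (dg' : 'I_r' -> nat) (dg : 'I_r -> nat) (A : 'M[S]_(r', r)) :
    'M[S]_(r', r) :=
  \matrix_(u, v) hpart (dg' u) (dg v) (A u v).

Lemma hrowM r' r (dg' : 'I_r' -> nat) (dg : 'I_r -> nat) (A : 'M[S]_(r', r)) D c :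
    (forall u v, homog_in (dg' u) (dg v) (A u v)) ->
  hrow dg D (c *m A) = hrow dg' D c *m A.
Proof.
move=> hA; apply/rowP => v; rewrite !mxE hpart_sum.
by apply: eq_bigr => u _; rewrite !mxE; apply: hpartMr.
Qed.

Lemma hmxMr r1 r2 r3 (d1 : 'I_r1 -> nat) (d2 : 'I_r2 -> nat) (d3 : 'I_r3 -> nat)
    (A : 'M[S]_(r1, r2)) (B : 'M[S]_(r2, r3)) :
    (forall u v, homog_in (d2 u) (d3 v) (B u v)) ->
  hmx d1 d3 (A *m B) = hmx d1 d2 A *m B.
Proof.
move=> hB; apply/matrixP => u v; rewrite !mxE hpart_sum.
by apply: eq_bigr => w _; rewrite !mxE; apply: hpartMr.
Qed.

Lemma hmxMl r1 r2 r3 (d1 : 'I_r1 -> nat) (d2 : 'I_r2 -> nat) (d3 : 'I_r3 -> nat)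
    (A : 'M[S]_(r1, r2)) (B : 'M[S]_(r2, r3)) :
    (forall u v, homog_in (d1 u) (d2 v) (A u v)) ->
  hmx d1 d3 (A *m B) = A *m hmx d2 d3 B.
Proof.
move=> hA; apply/matrixP => u v; rewrite !mxE hpart_sum.
by apply: eq_bigr => w _; rewrite !mxE; apply: hpartMl.
Qed.

(** Restricted to [I'], the identity still factors through the coordinates in [I], since the others
    contribute nothing; ranks give the inequality. *)
Lemma graded_inverse_leq (r r' : nat) (I : pred 'I_r) (I' : pred 'I_r')
    (A : 'M[K]_(r', r)) (B : 'M[K]_(r, r')) :
    A *m B = 1%:M ->
    (forall u u' v, I' u -> I' u' -> ~~ I v -> A u v * B v u' = 0) ->
  (#|I'| <= #|I|)%N.
Proof.
move=> AB1 AB0; apply: (@mulmx1_min K _ _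
  (\matrix_(i, j) A (enum_val i) (enum_val j))
  (\matrix_(j, i) B (enum_val j) (enum_val i))).
apply/matrixP => i j; rewrite !mxE.
transitivity (\sum_(v in I) A (enum_val i) v * B v (enum_val j)).
  by rewrite [RHS]big_enum_val; apply: eq_bigr => v _; rewrite !mxE.
have := congr1 (fun C : 'M_r' => C (enum_val i) (enum_val j)) AB1.
rewrite !mxE (inj_eq enum_val_inj) => <-.
rewrite [RHS](bigID (mem I)) /= [X in _ = _ + X]big1 ?addr0 // => v Iv.
by apply: AB0 => //; apply: (@enum_valP _ I').
Qed.

(** This replaces the directness of the grading of [M] in the comparison of resolutions: homogeneous
    elements have homogeneous preimages of the same degree. *)
Definition lifts_degrees (M : grmod K n) (F : gr_free_cplx M) : Prop :=
  forall k x, totcomp k x -> exists2 c : 'rV_(rank F 0),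
    forall v, homog_in k (deg v) (c 0 v) & aug F c = x.

Lemma hrow_id r (dg : 'I_r -> nat) D (c : 'rV[S]_r) :
  (forall v, homog_in D (dg v) (c 0 v)) -> hrow dg D c = c.
Proof. by move=> hc; apply/rowP => v; rewrite mxE hpart_id. Qed.

(** With [r] a homogeneous preimage of the same element, [c - r] is a boundary. Its component of
    degree [D] is again a boundary, because the differential preserves degrees, and it equals
    [hrow D c - r]. *)
Lemma aug_hrow (M : grmod K n) (F : gr_free_cplx M) D (c : 'rV_(rank F 0)) :
    is_free_resolution F -> is_graded F -> lifts_degrees F ->
    totcomp D (aug F c) -> aug F (hrow (@deg _ _ _ F 0) D c) = aug F c.
Proof.
move=> [_ exF _] [_ grF] liF /liF[r hr augr]; rewrite -augr.
have /exF[b bE] : aug F (c - r) = 0 by rewrite raddfB /= augr subrr.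
have : hrow (@deg _ _ _ F 0) D (c - r) = hrow (@deg _ _ _ F 1) D b *m dif F 0.
  by rewrite bE; apply: hrowM => u v; apply: grF.
have -> : hrow (@deg _ _ _ F 0) D (c - r) = hrow (@deg _ _ _ F 0) D c - r.
  by rewrite -[in RHS](hrow_id hr); apply/rowP => v; rewrite !mxE hpartB.
move=> E; apply/eqP; rewrite -subr_eq0 -raddfB; apply/eqP/exF.
by eexists; exact: E.
Qed.

(** Only the comparison map F' -> F is replaced by its degree-preserving part, as [F'] is not known
    to lift degrees. Both composites with F -> F' still lift the identity, so the constant parts are
    mutually inverse scalar matrices. One of them is block diagonal with respect to degrees, which
    makes blocks of equal degree equal in size. *)
Lemma graded_count (M : grmod K n) (F F' : gr_free_cplx M) :
    is_min_gr_free_resolution F -> lifts_degrees F ->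
    is_min_gr_free_resolution F' ->
  forall j k, #|[set v : 'I_(rank F j) | (deg v)%:Z == k]| =
              #|[set v : 'I_(rank F' j) | (deg v)%:Z == k]|.
Proof.
move=> [resF grF minF] liF [resF' grF' minF'] j k.
have [pF sF ddF exF] := free_resolution_exact resF.
have [pF' sF' ddF' exF'] := free_resolution_exact resF'.
have [f [f0 fE]] := chain_lift pF' ddF' exF (idfun : {linear M -> M}) sF.
have [g [g0 gE]] := chain_lift pF ddF exF' (idfun : {linear M -> M}) sF'.
pose A i : 'M[S]_(rank F' i, rank F i) :=
  hmx (@deg _ _ _ F' i) (@deg _ _ _ F i)
    (lin1_mx (f i.+1 : {linear 'rV_(rank F' i) -> 'rV_(rank F i)})).
have AE i : A i.+1 *m dif F i = dif F' i *m A i.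
  rewrite /A -(hmxMr _ _ (grF.2 i)) -(hmxMl _ _ (grF'.2 i)); congr hmx.
  apply/row_matrixP => u; rewrite !row_mul !rowE !mul_rV_lin1.
  have := fE i.+1 (delta_mx 0 u); rewrite /= => ->; congr (f i.+1 _).
have augA x : aug F (x *m A 0) = aug F' x.
  rewrite (row_sum_delta x) mulmx_suml !linear_sum; apply: eq_bigr => u _.
  rewrite -scalemxAl !linearZ; congr (_ *: _).
  have rowA : delta_mx 0 u *m A 0 =
      hrow (@deg _ _ _ F 0) (@deg _ _ _ F' 0 u) (f 1%N (delta_mx 0 u)).
    by apply/rowP => v; rewrite -rowE !mxE.
  have E : aug F (f 1%N (delta_mx 0 u)) = aug F' (delta_mx 0 u).
    by have := fE 0 (delta_mx 0 u); rewrite /= f0.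
  by rewrite rowA aug_hrow // E //; apply: grF'.1.
pose fh i : {linear augterm M (fterm F') i -> augterm M (fterm F) i} :=
  match i with
  | 0 => idfun
  | i.+1 => mulmxr (A i) : {linear 'rV_(rank F' i) -> 'rV_(rank F i)}
  end.
have fhE i x : augdif F i (fh i.+1 x) = fh i (augdif F' i x).
  by case: i x => [|i] x /=; [exact: augA | rewrite -!mulmxA AE].
pose gm := lin1_mx (g j.+1 : {linear 'rV_(rank F j) -> 'rV_(rank F' j)}).
pose cst a b (X : 'M[S]_(a, b)) : 'M[K]_(a, b) := map_mx (mcoeff 0%MM) X.
have endoF : cst _ _ gm *m cst _ _ (A j) = 1%:M.
  rewrite -map_mxM; apply/matrixP => u v; rewrite mxE [RHS]mxE.
  have := @minimal_endo_const _ _ M F (fun i => fh i \o g i) resF minF.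
  move=> /(_ g0) <-; last by move=> i x; rewrite /= fhE gE.
  by rewrite /= -mul_rV_lin1 -mulmxA -rowE [in RHS]mxE.
have endoF' : cst _ _ (A j) *m cst _ _ gm = 1%:M.
  rewrite -map_mxM; apply/matrixP => u v; rewrite mxE [RHS]mxE.
  have := @minimal_endo_const _ _ M F' (fun i => g i \o fh i) resF' minF'.
  move=> /(_ g0) <-; last by move=> i x; rewrite /= gE fhE.
  by rewrite /= -mul_rV_lin1 -mulmxA -rowE [in RHS]mxE.
have cstA u v : deg u != deg v -> cst _ _ (A j) u v = 0.
  rewrite !mxE /hpart => neq_uv; case: leqP => [le_vu|_]; last exact: mcoeff0.
  apply: (dhomog_nemf_coeff (pihomogP _ _ _)).
  by rewrite /= mdeg0 eq_sym subn_eq0 -ltnNge ltn_neqAle eq_sym neq_uv.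
apply: anti_leq; rewrite !cardsE; apply/andP; split.
  apply: (graded_inverse_leq endoF) => v v' u /= _ /eqP v'k uk.
  by rewrite cstA ?mulr0 //; apply: contra uk => /eqP->; apply/eqP.
apply: (graded_inverse_leq endoF') => u u' v /= /eqP uk _ vk.
by rewrite cstA ?mul0r //; apply: contra vk => /eqP<-; apply/eqP.
Qed.

Lemma betti_count (M : grmod K n) (F : gr_free_cplx M) :
    is_min_gr_free_resolution F -> lifts_degrees F ->
  forall (j : nat) k, betti M j k = #|[set v : 'I_(rank F j) | (deg v)%:Z == k]|.
Proof.
move=> minF liF j k; rewrite /betti; case: pselect => [ex|[]]; last by exists F.
by rewrite (graded_count minF liF (projT2 (cid ex))).
Qed.
End BettiUniqueness.

(** * Components of a given multidegree *)

Section Strands.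
Variables (K : fieldType) (n : nat).
Local Notation S := {mpoly K[n]}.
Implicit Types (F G : mgfree n) (d : 'X_{1..n}).

Lemma mcoeffMZX (p : S) (c : K) (a k : 'X_{1..n}) :
  (p * (c *: 'X_[a]))@_k = if (a <= k)%MM then p@_(k - a) * c else 0.
Proof.
rewrite -scalerAr mcoeffZ mulrC; case: ifP => [le_ak|nle_ak].
  by rewrite -{1}(submK le_ak) [(k - a + a)%MM]addmC mcoeffMX.
rewrite {1}(mpolyE p) mulr_suml raddf_sum big1 ?mul0r //= => m _.
rewrite -scalerAl mcoeffZ -mpolyXD mcoeffX.
by case: eqP => [E|_]; [rewrite -E lem_addl in nle_ak | rewrite mulr0].
Qed.

(* the coordinates of the component of multidegree [d] *)
Definition strand F d (r : 'rV[S]_(mgrank F)) : 'rV[K]_(mgrank F) :=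
  \row_u (if (shift u <= d)%MM then (r 0 u)@_(d - shift u) else 0).

Definition unstrand F d (l : 'rV[K]_(mgrank F)) : 'rV[S]_(mgrank F) :=
  \row_u (l 0 u *: 'X_[(d - shift u)%MM]).

(** Subtraction of multidegrees is truncated, so [unstrand d] is meaningful only on coordinates
    whose shift divides [d]. *)
Definition below F d (l : 'rV[K]_(mgrank F)) : Prop :=
  forall u, ~~ (shift u <= d)%MM -> l 0 u = 0.

Lemma below_strand F d r : below d (strand d r : 'rV_(mgrank F)).
Proof. by move=> u /negPf nle; rewrite mxE nle. Qed.

Lemma below_mul F G (phi : mghom K F G) d l :
  below d l -> below d (l *m coef phi).
Proof.
move=> bl v nle; rewrite mxE big1 // => u _.
have [le_ud|/bl->] := boolP (shift u <= d)%MM; last by rewrite mul0r.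
rewrite coef_eq0 ?mulr0 //; apply: contra nle => le_vu; exact: lepm_trans le_ud.
Qed.

Lemma strandK F d l : below d l -> strand d (unstrand d l) = l :> 'rV_(mgrank F).
Proof.
move=> bl; apply/rowP => u; rewrite !mxE mcoeffZ mcoeffX eqxx mulr1.
by case: ifPn => // /bl.
Qed.

Lemma strand_mul F G (phi : mghom K F G) d r :
  strand d (r *m mghom_mx phi) = strand d r *m coef phi.
Proof.
apply/rowP => v; rewrite !mxE raddf_sum /=.
transitivity (\sum_u (if (shift v <= d)%MM then
    (r 0 u * (coef phi u v *: 'X_[(shift u - shift v)%MM]))@_(d - shift v) else 0)).
  by case: ifP => _; [apply: eq_bigr => u _; rewrite mxE | rewrite big1].
apply: eq_bigr => u _; rewrite mxE mcoeffMZX.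
have [le_vu|nle_vu] := boolP (shift v <= shift u)%MM; last first.
  by rewrite coef_eq0 // !mulr0 !if_same.
case: (boolP (shift u <= d)%MM) => [le_ud|nle_ud].
  rewrite (lepm_trans le_vu le_ud).
  have -> : (d - shift v - (shift u - shift v) = d - shift u)%MM.
    apply/mnmP => i; rewrite !mnmBE.
    by move/mnm_lepP/(_ i): le_vu => le_vu; rewrite subnBA // subnK // (leq_trans le_vu) //; move/mnm_lepP/(_ i): le_ud.
  case: ifP => // /negP[]; apply/mnm_lepP => i; rewrite !mnmBE.
  by apply: leq_sub2r; move/mnm_lepP/(_ i): le_ud.
rewrite mul0r; case: ifP => // le_vd; case: ifP => // le_uvd.
case/negP: nle_ud; apply/mnm_lepP => i; move/mnm_lepP/(_ i): le_uvd.
rewrite !mnmBE leq_subLR subnKC //; first by move/mnm_lepP/(_ i): le_vd.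
Qed.

Lemma unstrand_mul F G (phi : mghom K F G) d l :
  below d l -> unstrand d l *m mghom_mx phi = unstrand d (l *m coef phi).
Proof.
move=> bl; apply/rowP => v; rewrite !mxE scaler_suml.
apply: eq_bigr => u _; rewrite !mxE.
have [le_ud|/bl->] := boolP (shift u <= d)%MM; last by rewrite mul0r !scale0r mul0r.
have [le_vu|nle_vu] := boolP (shift v <= shift u)%MM; last first.
  by rewrite coef_eq0 // !mulr0 !scale0r mulr0.
rewrite -scalerAl -scalerAr scalerA -mpolyXD; congr (_ *: 'X_[_]).
apply/mnmP => i; rewrite mnmDE !mnmBE.
move/mnm_lepP/(_ i): le_ud => le_ud; move/mnm_lepP/(_ i): le_vu => le_vu.
by rewrite addnBA // subnK.
Qed.

(** The list [s0] lets the caller force degrees into the sum in which [r] may have no component. *)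
Lemma strand_partition F (r : 'rV[S]_(mgrank F)) (s0 : seq 'X_{1..n}) :
  exists s, [/\ uniq s, {subset s0 <= s} & r = \sum_(d <- s) unstrand d (strand d r)].
Proof.
pose s := undup (s0 ++ flatten [seq [seq (m + shift u)%MM | m <- msupp (r 0 u)] | u : 'I_(mgrank F)]).
have uniq_s : uniq s by apply: undup_uniq.
exists s; split=> //; first by move=> d ds; rewrite mem_undup mem_cat ds.
apply/rowP => u; rewrite summxE; apply/mpolyP => m; rewrite raddf_sum /=.
rewrite (eq_bigr (fun d => if d == (m + shift u)%MM then (r 0 u)@_m else 0)).
  have [ms|] := boolP ((m + shift u)%MM \in s).
    by rewrite -big_mkcond /= -big_filter filter_pred1_uniq // big_seq1.
  rewrite mem_undup mem_cat negb_or => /andP[_ ms].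
  suff -> : (r 0 u)@_m = 0 by rewrite big1 // => d _; rewrite if_same.
  apply: memN_msupp_eq0; apply: contra ms => ms.
  by apply/flattenP; eexists; [apply: image_f | apply: map_f].
move=> d _; rewrite !mxE mcoeffZ mcoeffX.
case: ifPn => [le_ud|nle_ud]; last first.
  by rewrite mul0r; case: eqP nle_ud => // ->; rewrite lem_addl.
have -> : (d - shift u == m)%MM = (d == m + shift u)%MM.
  by rewrite -(eqm_add2r (shift u)) submK.
by case: eqP => [->|]; rewrite ?addmK ?mulr1 ?mulr0.
Qed.

Lemma strand_eq0 F (r : 'rV[S]_(mgrank F)) : (forall d, strand d r = 0) -> r = 0.
Proof.
move=> r0; have [s [_ _ ->]] := strand_partition r [::].
rewrite big1 // => d _; rewrite r0; apply/rowP => u.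
by rewrite !mxE scale0r.
Qed.

Lemma strand0 F d : strand d 0 = 0 :> 'rV_(mgrank F).
Proof. by apply/rowP => u; rewrite !mxE mcoeff0 if_same. Qed.

Lemma below_delta F (u : 'I_(mgrank F)) : below (shift u) (delta_mx 0 u : 'rV_(mgrank F)).
Proof.
by move=> v; rewrite mxE /=; case: eqP => // ->; rewrite lepm_refl.
Qed.

Lemma unstrand_delta F (u : 'I_(mgrank F)) :
  unstrand (shift u) (delta_mx 0 u) = delta_mx 0 u.
Proof.
apply/rowP => v; rewrite !mxE /=; case: eqP => [->|_]; last by rewrite scale0r.
have -> : (shift u - shift u = 0)%MM by apply/mnmP => i; rewrite mnmBE subnn mnm0E.
by rewrite scale1r mpolyX0.
Qed.

Lemma image_of_strands F1 F2 (phi : mghom K F1 F2) (c : 'rV_(mgrank F2)) :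
    (forall d, exists2 l, below d l & strand d c = l *m coef phi) ->
  exists b, c = b *m mghom_mx phi.
Proof.
move=> ex; have [s [_ _ ->]] := strand_partition c [::].
elim: s => [|d s [b bE]]; first by exists 0; rewrite big_nil mul0mx.
have [l bl lE] := ex d; exists (unstrand d l + b).
by rewrite big_cons bE mulmxDl lE unstrand_mul.
Qed.

Lemma exact_of_strands F1 F2 F3 (phi : mghom K F1 F2) (psi : mghom K F2 F3) :
    coef phi *m coef psi = 0 ->
    (forall d l, below d l -> l *m coef psi = 0 ->
      exists2 l', below d l' & l = l' *m coef phi) ->
  forall c : 'rV_(mgrank F2), c *m mghom_mx psi = 0 <-> exists b, c = b *m mghom_mx phi.
Proof.
move=> pp0 ex c; split=> [c0|[b ->]]; last first.
  by apply: strand_eq0 => d; rewrite !strand_mul -mulmxA pp0 mulmx0.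
apply: image_of_strands => d; apply: ex; first exact: below_strand.
by rewrite -strand_mul c0 strand0.
Qed.

Lemma strands_of_exact F1 F2 F3 (phi : mghom K F1 F2) (psi : mghom K F2 F3) :
    (forall c : 'rV_(mgrank F2), c *m mghom_mx psi = 0 <-> exists b, c = b *m mghom_mx phi) ->
  coef phi *m coef psi = 0 /\
  forall d l, below d l -> l *m coef psi = 0 ->
      exists2 l', below d l' & l = l' *m coef phi.
Proof.
move=> ex; split.
  apply/row_matrixP => u; rewrite row0 row_mul rowE -mulmxA.
  (* Row [u] of the product is read off in multidegree [shift u], where generator [u] itself appears
     with coefficient 1. *)
  have /ex E : exists b, (delta_mx 0 u : 'rV_(mgrank F1)) *m mghom_mx phi = b *m mghom_mx phi by eexists.
  have := congr1 (strand (shift u)) E; rewrite !strand_mul strand0 => E0.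
  apply: etrans E0; rewrite mulmxA; congr (_ *m _ *m _).
  by rewrite -(unstrand_delta u) strandK //; apply: below_delta.
move=> d l bl l0.
have /ex[b bE] : unstrand d l *m mghom_mx psi = 0.
  by rewrite unstrand_mul // l0; apply/rowP => v; rewrite !mxE scale0r.
exists (strand d b); first exact: below_strand.
by rewrite -strand_mul -bE strandK.
Qed.

End Strands.

(** * Homogeneous preimages under a multigraded augmentation *)

Section MultigradedAugmentation.
Variables (K : fieldType) (n : nat) (M : grmod K n).
Local Notation S := {mpoly K[n]}.
Hypothesis M_graded : multigraded M.
Variables (F : mgfree n) (a : {linear 'rV[S]_(mgrank F) -> M}).
Hypothesis a_homog : mgaug_homog a.

Lemma mgcomp_unstrand d l : below d l -> mgcomp d (a (unstrand d l)).
Proof.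
move=> bl; have [M0 Mmul _ _] := M_graded; have [C0 CD] := M0 d.
have CD1 x y : mgcomp d x -> mgcomp d y -> mgcomp d (x + y : M).
  by move=> Cx Cy; have := CD 1 _ _ Cx Cy; rewrite scale1r.
have CZ c x : mgcomp d x -> mgcomp d (c%:MP *: x : M).
  by move=> Cx; rewrite -[_ *: _]addr0; apply: CD.
rewrite (row_sum_delta (unstrand d l)) linear_sum.
elim/big_ind: _ => // u _; rewrite linearZ mxE /= -mul_mpolyC -scalerA.
have [le_ud|/bl->] := boolP (shift u <= d)%MM; last by rewrite mpolyC0 scale0r.
by apply: CZ; rewrite -{1}(submK le_ud); apply: Mmul; apply: a_homog.
Qed.

Lemma mgcomp_lift d y : (exists r, a r = y) -> mgcomp d y ->
  exists2 l, below d l & a (unstrand d l) = y.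
Proof.
move=> [r ry] yd; have [M0 Mmul _ Mdir] := M_graded.
have [s [uniq_s sub_s rE]] := strand_partition r [:: d].
have ds : d \in s by apply: sub_s; rewrite mem_head.
(* These are the homogeneous components of [a r - y], which is zero; directness kills each of them,
   and the one at [d] says that the strand of [r] at [d] is a preimage of [y]. *)
pose f d' := a (unstrand d' (strand d' r)) - (if d' == d then y else 0).
have fC d' : mgcomp d' (f d').
  have [C0 CD] := M0 d'; have Cr := mgcomp_unstrand (@below_strand _ _ F d' r).
  rewrite /f; case: eqP => [E|_]; last by rewrite subr0.
  rewrite E in Cr C0 CD *; have := CD (-1) _ _ yd Cr.
  by rewrite addrC mpolyCN mpolyC1 scaleN1r.
have f0 : \sum_(d' <- s) f d' = 0.
  rewrite big_split /= sumrN -linear_sum -rE ry.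
  by rewrite -big_mkcond /= -big_filter filter_pred1_uniq // big_seq1 subrr.
exists (strand d r); first exact: below_strand.
have /eqP := Mdir s f uniq_s fC f0 d ds.
by rewrite /f eqxx subr_eq0 => /eqP.
Qed.

End MultigradedAugmentation.

(** * Splitting a variable *)

Section FreeModules.
Variable K : fieldType.
Implicit Types (A B : finType) (V W : lmodType K).

(** Vectors are functions on a finite type rather than rows, so that bases may be dependent sums
    without any numbering. *)
Definition ebasis B (b : B) : {ffun B -> K^o} := [ffun b' => (b' == b)%:R].

Definition lin B V (f : B -> V) (v : {ffun B -> K^o}) : V := \sum_b v b *: f b.

Lemma lin_is_linear B V (f : B -> V) : linear (lin f).
Proof.
move=> c v w; rewrite /lin scaler_sumr -big_split; apply: eq_bigr => b _ /=.
by rewrite !ffunE scalerDl scalerA.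
Qed.

HB.instance Definition _ B V (f : B -> V) :=
  GRing.isLinear.Build K {ffun B -> K^o} V _ (lin f) (lin_is_linear f).

Lemma lin_ebasis B V (f : B -> V) b : lin f (ebasis b) = f b.
Proof.
rewrite /lin (bigD1 b) //= ffunE eqxx scale1r big1 ?addr0 // => b' /negPf neq.
by rewrite ffunE neq scale0r.
Qed.

Lemma linear_lin B V W (g : {linear V -> W}) (f : B -> V) v :
  g (lin f v) = lin (fun b => g (f b)) v.
Proof. by rewrite /lin linear_sum; apply: eq_bigr => b _; rewrite linearZ. Qed.

Lemma lin_ebasis_id B v : lin (@ebasis B) v = v.
Proof.
apply/ffunP => b; rewrite /lin sum_ffunE (bigD1 b) //= big1 ?addr0.
  by rewrite !ffunE eqxx; exact: mulr1.
by move=> b' neq; rewrite !ffunE eq_sym (negPf neq); exact: mulr0.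
Qed.

Lemma eq_lin B V (f g : B -> V) (v : {ffun B -> K^o}) :
  (forall b, v b != 0 -> f b = g b) -> lin f v = lin g v.
Proof.
move=> fg; apply: eq_bigr => b _; have [->|/fg->//] := eqVneq (v b) 0.
by rewrite !scale0r.
Qed.

Lemma linD B V (f g : B -> V) v : lin (fun b => f b + g b) v = lin f v + lin g v.
Proof. by rewrite /lin -big_split; apply: eq_bigr => b _; rewrite scalerDr. Qed.

Lemma linB B V (f g : B -> V) v : lin (fun b => f b - g b) v = lin f v - lin g v.
Proof.
by rewrite /lin -sumrB; apply: eq_bigr => b _; rewrite scalerBr.
Qed.

Lemma lin_sum B V (I : Type) (r : seq I) (f : I -> B -> V) v :
  lin (fun b => \sum_(i <- r) f i b) v = \sum_(i <- r) lin (f i) v.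
Proof.
rewrite /lin exchange_big; apply: eq_bigr => b _ /=; exact: scaler_sumr.
Qed.

Lemma lin_neq0 A B (f : A -> {ffun B -> K^o}) (v : {ffun A -> K^o}) b :
  lin f v b != 0 -> exists2 a, v a != 0 & f a b != 0.
Proof.
rewrite /lin sum_ffunE => nz.
have [a anz] : exists a, (v a *: f a) b != 0.
  apply/existsP; rewrite -negb_forall; apply: contra nz => /forallP z.
  by rewrite big1 // => a _; apply/eqP; rewrite z.
exists a; first by apply: contra anz => /eqP->; rewrite scale0r ffunE.
by apply: contra anz => /eqP z; rewrite ffunE z; exact/eqP/mulr0.
Qed.

Lemma ebasis_neq0 B (b b' : B) : ebasis b b' != 0 -> b' = b.
Proof. by rewrite ffunE; case: (b' =P b) => //= _ /eqP[]. Qed.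
End FreeModules.

(** * Multigraded complexes on a finite basis, and the splitting of one variable *)

Section BasedComplexes.
Variables (K : fieldType) (N : nat).

(* A complex of multigraded free modules with a finite basis, all homological
   degrees together: the coefficient of [b'] in the image of [b] is
   [bdif b b'] times a monomial. *)
Record bcplx := BCplx {
  bset : finType;
  bhd : bset -> nat;
  bsh : bset -> 'X_{1..N};
  bdif : bset -> {ffun bset -> K^o} }.

Implicit Types (B C : bcplx) (c : 'X_{1..N}).

(** The strict drop of total degree is minimality: every nonzero entry is a scalar times a monomial
    other than 1. The last clause says that the differential squares to zero. *)
Definition bminimal B : Prop :=
  (forall b b' : bset B, bdif b b' != 0 ->
    [/\ bhd b = (bhd b').+1, (bsh b' <= bsh b)%MM & (mdeg (bsh b') < mdeg (bsh b))%N]) /\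
  (forall b, lin (@bdif B) (bdif b) = 0).

Definition bbelow B c (v : {ffun bset B -> K^o}) : Prop :=
  forall b, v b != 0 -> (bsh b <= c)%MM.

Definition bpure B j (v : {ffun bset B -> K^o}) : Prop :=
  forall b, v b != 0 -> bhd b = j.

(* [eps] makes the component of multidegree [c] of [C] quasi-isomorphic to that
   of multidegree [kap c] of [B]. *)
Record expands (kap : 'X_{1..N} -> 'X_{1..N}) C B
    (eps : bset C -> {ffun bset B -> K^o}) : Prop := Expands {
  expands_mono : forall c c', (c <= c')%MM -> (kap c <= kap c')%MM;
  expands_degree : forall e b, eps e b != 0 ->
    bhd b = bhd e /\ (bsh b <= kap (bsh e))%MM;
  expands_chain : forall e, lin eps (bdif e) = lin (@bdif B) (eps e);
  expands_exact : forall c v z, bbelow c v -> lin (@bdif C) v = 0 ->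
    bbelow (kap c) z -> lin eps v = lin (@bdif B) z ->
    exists2 w, bbelow c w & v = lin (@bdif C) w;
  expands_onto : forall c j z, bbelow (kap c) z -> bpure j z ->
    exists v, [/\ bbelow c v, bpure j v & lin eps v = z] }.

Lemma expands_chain_lin kap C B eps (E : @expands kap C B eps) v :
  lin eps (lin (@bdif C) v) = lin (@bdif B) (lin eps v).
Proof.
rewrite !linear_lin; apply: eq_lin => e _; exact: (expands_chain E).
Qed.

Lemma expands_below kap C B eps (E : @expands kap C B eps) c v :
  bbelow c v -> bbelow (kap c) (lin eps v).
Proof.
move=> bv b /lin_neq0[e /bv le_ec /(expands_degree E)[_ le_be]].
exact: lepm_trans le_be (expands_mono E le_ec).
Qed.

Lemma expands_refl B : expands id (@ebasis K (bset B)).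
Proof.
split=> // [e b /ebasis_neq0->|e|c v z bv v0 bz|c j z bz pz].
- by split=> //; apply: lepm_refl.
- by rewrite lin_ebasis_id lin_ebasis.
- by rewrite lin_ebasis_id => ->; exists z.
- by exists z; rewrite lin_ebasis_id.
Qed.

(** A cycle of [C] whose image in [A] bounds has as image in [B] a cycle with the same property; so
    the latter bounds, and then so does the former. *)
Lemma expands_trans kap kap' C B A eps eps' :
    @expands kap C B eps -> @expands kap' B A eps' ->
  expands (kap' \o kap) (fun e => lin eps' (eps e)).
Proof.
move=> E E'; split.
- by move=> c c' /(expands_mono E)/(expands_mono E').
- move=> e a /lin_neq0[b /(expands_degree E)[hb sb] /(expands_degree E')[ha sa]].
  by rewrite ha hb; split=> //; apply: lepm_trans sa (expands_mono E' sb).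
- by move=> e; rewrite -(linear_lin (lin eps')) (expands_chain E); exact: expands_chain_lin E' _.
- move=> c v z bv v0 bz; rewrite -(linear_lin (lin eps')) => ez.
  have b1 := expands_below E bv.
  have c1 : lin (@bdif B) (lin eps v) = 0.
    by apply: etrans (esym (expands_chain_lin E v)) _; rewrite v0 linear0.
  have [w bw ew] := expands_exact E' b1 c1 bz ez.
  exact: (expands_exact E) bv v0 bw ew.
- move=> c j z bz pz; have [w [bw pw <-]] := expands_onto E' bz pz.
  have [v [bv pv <-]] := expands_onto E bw pw.
  by exists v; rewrite -(linear_lin (lin eps')).
Qed.

Section Split.
Variables (x y : 'I_N) (B : bcplx).

(* (x, y)^a has the generators x^(a-i) y^i, 0 <= i <= a, and the syzygies
   y.(x^(a-t) y^t) = x.(x^(a-t-1) y^(t+1)), 0 <= t < a. *)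
Definition split_set : finType :=
  {b : bset B & ('I_(bsh b x).+1 + 'I_(bsh b x))%type}.

Definition split_inl (b : bset B) (i : 'I_(bsh b x).+1) : split_set := existT _ b (inl i).
Definition split_inr (b : bset B) (t : 'I_(bsh b x)) : split_set := existT _ b (inr t).

Definition split_gen (b : bset B) (i : nat) : {ffun split_set -> K^o} :=
  ebasis K (@split_inl b (inord i)).

(** The value 0 out of range is forced by functoriality: once a' <= t, both g_(t+1) and g_t go to
    g_(a'), so their difference must be lifted by 0. *)
Definition split_syz (b : bset B) (t : nat) : {ffun split_set -> K^o} :=
  if (insub t : option 'I_(bsh b x)) is Some o
  then ebasis K (split_inr o)
  else 0.

(** The differential of the total complex; the minus sign on syzygies makes the two directions
    anticommute. *)
Definition split_dif (e : split_set) : {ffun split_set -> K^o} :=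
  match tagged e with
  | inl i => lin (fun b => split_gen b (minn i (bsh b x))) (bdif (tag e))
  | inr t => split_gen (tag e) t.+1 - split_gen (tag e) t
             - lin (fun b => split_syz b t) (bdif (tag e))
  end.

Definition split_cplx : bcplx := @BCplx split_set
  (fun e => match tagged e with inl _ => bhd (tag e) | inr _ => (bhd (tag e)).+1 end)
  (fun e => match tagged e with
     | inl i => (bsh (tag e) - U_(x) *+ i + U_(y) *+ i)%MM
     | inr t => (bsh (tag e) - U_(x) *+ t + U_(y) *+ t.+1)%MM end)
  split_dif.

Definition split_eps (e : split_set) : {ffun bset B -> K^o} :=
  match tagged e with inl _ => ebasis K (tag e) | inr _ => 0 end.

(** On exponents this is the substitution y |-> x, except that the exponent of y is kept; this is
    harmless, since the shifts of [B] do not involve y. *)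
Definition split_kap c : 'X_{1..N} := (c + U_(x) *+ c y)%MM.

Hypothesis xy : x != y.
Hypothesis B_min : bminimal B.
Hypothesis B_y : forall b : bset B, bsh b y = 0%N.

Lemma lin_split_gen (V : lmodType K) (f : split_set -> V) b i : (i <= bsh b x)%N ->
  lin (V := V) f (split_gen b i) = f (@split_inl b (inord i)).
Proof. by rewrite /split_gen lin_ebasis. Qed.

Lemma split_gen_neq0 b i e : (i <= bsh b x)%N -> split_gen b i e != 0 ->
  exists2 o : 'I_(bsh b x).+1, o = i :> nat & e = split_inl o.
Proof. by move=> ib /ebasis_neq0 ->; exists (inord i) => //; rewrite inordK. Qed.

Lemma split_syz_neq0 b t e : split_syz b t e != 0 ->
  exists2 o : 'I_(bsh b x), o = t :> nat & e = split_inr o.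
Proof.
rewrite /split_syz; case: insubP => [o _ oE|_]; last by rewrite ffunE eqxx.
by move=> /ebasis_neq0 ->; exists o.
Qed.

Lemma split_syz_lt b (o : 'I_(bsh b x)) : split_syz b o = ebasis K (split_inr o).
Proof. by rewrite /split_syz insubT //= => lt; congr (ebasis K (split_inr _)); apply: val_inj. Qed.

Lemma split_syz_ge b t : (bsh b x <= t)%N -> split_syz b t = 0.
Proof. by move=> le; rewrite /split_syz insubF // ltnNge le. Qed.

Lemma split_dif_gen b i : (i <= bsh b x)%N ->
  lin split_dif (split_gen b i) = lin (fun b' => split_gen b' (minn i (bsh b' x))) (bdif b).
Proof. by move=> ib; rewrite lin_split_gen // /split_dif /= inordK. Qed.

Lemma split_dif_syz b t : (t < bsh b x)%N ->
  lin split_dif (split_syz b t) =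
  split_gen b t.+1 - split_gen b t - lin (fun b' => split_syz b' t) (bdif b).
Proof.
by move=> tb; rewrite (split_syz_lt (Ordinal tb)) lin_ebasis.
Qed.

Lemma bdif_shx (b b' : bset B) : bdif b b' != 0 -> (bsh b' x <= bsh b x)%N.
Proof. by move=> /B_min.1[_ /mnm_lepP/(_ x)]. Qed.

Lemma lin_bdif (V : lmodType K) (f : bset B -> V) (b : bset B) :
  lin (V := V) (fun b' => lin f (bdif b')) (bdif b) = 0.
Proof.
have -> : lin (fun b' => lin f (bdif b')) (bdif b) = lin f (lin (@bdif B) (bdif b)).
  by rewrite linear_lin.
by rewrite B_min.2 linear0.
Qed.

Lemma split_difK e : lin split_dif (split_dif e) = 0.
Proof.
case: e => b [i|t]; rewrite {2}/split_dif /=.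
  rewrite (linear_lin (lin split_dif)) /= -[RHS](lin_bdif (fun b'' : bset B => split_gen b'' (minn i (bsh b'' x))) b).
  apply: eq_lin => b' bb'; rewrite split_dif_gen ?geq_minr //.
  apply: eq_lin => b'' /bdif_shx le; congr split_gen.
  by rewrite -minnA (minn_idPr le).
have tb := ltn_ord t.
rewrite !linearB /= !split_dif_gen ?(ltnW tb) // (linear_lin (lin split_dif)) /= -!linB.
rewrite -[RHS](lin_bdif (fun b'' : bset B => split_syz b'' t) b).
apply: eq_lin => b' /bdif_shx le; have [ltb'|leb'] := ltnP t (bsh b' x).
  by rewrite split_dif_syz // (minn_idPl ltb') subKr.
(* Over [b'] the path ends before step [t]: both generators are its last vertex and the syzygy is
   0. *)
rewrite (minn_idPr (leqW leb')) split_syz_ge // linear0 !subrr.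
rewrite /lin big1 // => b'' _; have [->|/bdif_shx le'] := eqVneq (bdif b' b'') 0.
  by rewrite scale0r.
by rewrite split_syz_ge ?scaler0 // (leq_trans le').
Qed.

Lemma mdeg_split (m : 'X_{1..N}) i j : (i <= m x)%N ->
  mdeg (m - U_(x) *+ i + U_(y) *+ j) = (mdeg m - i + j)%N.
Proof.
move=> im; rewrite mdegD !mdegMn mdeg1 !mul1n; congr (_ + _)%N.
have le_m : (U_(x) *+ i <= m)%MM.
  by apply/mnm_lepP => k; rewrite mulmnE mnm1E; case: eqP => [<-|_]; rewrite ?mul1n.
by rewrite -{2}(submK le_m) mdegD mdegMn mdeg1 mul1n addnK.
Qed.

Lemma leq_mdeg_x (m : 'X_{1..N}) : (m x <= mdeg m)%N.
Proof. by rewrite mdegE (bigD1 x) //= leq_addr. Qed.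

(** A generator g_i has total degree |a| and a syzygy s_t has |a| + 1. So the vertical maps lower
    the degree by 1, and the horizontal ones by as much as those of [B]. *)
Lemma split_minimal : bminimal split_cplx.
Proof.
split; last exact: split_difK.
move=> [b e] e'; rewrite /= /split_dif /=; case: e => [i|t].
  move=> /lin_neq0[b' bb' /split_gen_neq0[|o oE ->]]; first exact: geq_minr.
  have [hb sb mb] := B_min.1 _ _ bb'.
  have le_i : (i <= bsh b x)%N by rewrite -ltnS.
  have le_o : (o <= bsh b' x)%N by rewrite -ltnS.
  rewrite /= !mdeg_split //.
  rewrite !subnK ?(leq_trans le_i) ?(leq_trans le_o) ?leq_mdeg_x //.
  split=> //; apply/mnm_lepP => k; rewrite !mnmDE !mnmBE !mulmnE !mnm1E oE.
  move/mnm_lepP/(_ k): sb => sb; apply: leq_add.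
    case: eqP => [kx|_]; last by rewrite !mul0n !subn0.
    rewrite !mul1n -kx; have [le|le] := leqP i (bsh b' x).
      by apply: leq_sub2r; rewrite kx.
    by rewrite subnn.
  by case: eqP => // _; rewrite ?mul1n ?mul0n // geq_minl.
have tb := ltn_ord t.
have subE (f g h : {ffun split_set -> K^o}) : (f - g - h) e' = f e' - g e' - h e'.
  by rewrite !ffunE.
rewrite subE => nz.
have [/split_gen_neq0[//|o oE ->]|g1] := boolP (split_gen b t.+1 e' != 0).
  rewrite /= !mdeg_split ?oE ?(ltnW tb) // subnK ?(leq_trans tb (leq_mdeg_x _)) //.
  rewrite addnS subnK ?(leq_trans (ltnW tb) (leq_mdeg_x _)) //; split=> //.
  apply/mnm_lepP => k; rewrite !mnmDE !mnmBE !mulmnE leq_add2r.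
  by apply: leq_sub2l; rewrite leq_mul2l leqnSn orbT.
have [/split_gen_neq0[|o oE ->]|g2] := boolP (split_gen b t e' != 0); first exact: ltnW.
  rewrite /= !mdeg_split ?oE ?(ltnW tb) //.
  rewrite addnS subnK ?(leq_trans (ltnW tb) (leq_mdeg_x _)) //; split=> //.
  apply/mnm_lepP => k; rewrite !mnmDE !mnmBE !mulmnE leq_add2l.
  by rewrite leq_mul2l leqnSn orbT.
have /lin_neq0[b' bb' /split_syz_neq0[o oE ->]] :
    lin (fun b' => split_syz b' t) (bdif b) e' != 0.
  apply: contra nz => /eqP->; move: g1 g2; rewrite !negbK => /eqP-> /eqP->.
  by rewrite !subr0.
have [hb sb mb] := B_min.1 _ _ bb'; have ob' := ltn_ord o.
rewrite /= !mdeg_split ?(ltnW tb) ?(ltnW ob') // !addnS oE.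
rewrite oE in ob'; rewrite !subnK ?(leq_trans (ltnW tb) (leq_mdeg_x _)) //;
  last exact: leq_trans (ltnW ob') (leq_mdeg_x _).
rewrite hb; split=> //; apply/mnm_lepP => k; rewrite !mnmDE !mnmBE leq_add2r.
by apply: leq_sub2r; move/mnm_lepP: sb.
Qed.

Lemma split_sh_other (z : 'I_N) (e : bset split_cplx) : z != x -> z != y ->
  bsh e z = bsh (tag e) z.
Proof.
move=> zx zy; case: e => b [i|t] /=; rewrite mnmDE mnmBE !mulmnE !mnm1E;
  by rewrite ![_ == z]eq_sym (negPf zx) (negPf zy) !mul0n subn0 addn0.
Qed.

Definition le_off (m c : 'X_{1..N}) : bool :=
  [forall z, [|| z == x, z == y | m z <= c z]%N].

Lemma split_le (m c : 'X_{1..N}) i j : m y = 0%N ->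
  (m - U_(x) *+ i + U_(y) *+ j <= c)%MM =
  [&& le_off m c, m x - i <= c x & j <= c y]%N.
Proof.
move=> my; apply/mnm_lepP/and3P => [le|[/forallP off lex ley] z].
  split; last 2 first.
  - by have := le x; rewrite mnmDE mnmBE !mulmnE !mnm1E eqxx eq_sym (negPf xy) mul1n mul0n addn0.
  - by have := le y; rewrite mnmDE mnmBE !mulmnE !mnm1E eqxx (negPf xy) mul1n my sub0n.
  apply/forallP => z; have := le z; rewrite mnmDE mnmBE !mulmnE !mnm1E ![_ == z]eq_sym.
  by case: eqP => //= _; case: eqP => //= _; rewrite !mul0n subn0 addn0.
rewrite mnmDE mnmBE !mulmnE !mnm1E ![_ == z]eq_sym; have := off z.
case: eqP => [->|_] /=; first by rewrite (negPf xy) mul1n mul0n addn0.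
by case: eqP => [->|_] /=; rewrite ?my ?mul0n ?mul1n ?subn0 ?addn0.
Qed.

Lemma split_kap_le (m c : 'X_{1..N}) : m y = 0%N ->
  (m <= split_kap c)%MM = le_off m c && (m x <= c x + c y)%N.
Proof.
move=> my; apply/mnm_lepP/andP => [le|[/forallP off lex] z].
  split; last by have := le x; rewrite mnmDE mulmnE mnm1E eqxx mul1n.
  apply/forallP => z; have := le z; rewrite mnmDE mulmnE mnm1E [_ == z]eq_sym.
  by case: eqP => //= _; rewrite mul0n addn0 => ->; rewrite orbT.
rewrite mnmDE mulmnE mnm1E [_ == z]eq_sym; have := off z.
case: eqP => [->|_] /=; first by rewrite mul1n.
by case: eqP => [->|_] /=; rewrite ?my ?mul0n ?addn0.
Qed.

Lemma split_inl_le b (o : 'I_(bsh b x).+1) c :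
  (bsh (split_inl o : bset split_cplx) <= c)%MM =
  [&& le_off (bsh b) c, bsh b x - o <= c x & o <= c y]%N.
Proof. by rewrite /= split_le. Qed.

Lemma split_inr_le b (o : 'I_(bsh b x)) c :
  (bsh (split_inr o : bset split_cplx) <= c)%MM =
  [&& le_off (bsh b) c, bsh b x - o <= c x & o < c y]%N.
Proof. by rewrite /= split_le. Qed.

Lemma split_kap_mono c c' : (c <= c')%MM -> (split_kap c <= split_kap c')%MM.
Proof.
move=> /mnm_lepP le; apply/mnm_lepP => z; rewrite !mnmDE !mulmnE.
by apply: leq_add => //; rewrite leq_mul2l le orbT.
Qed.

(* On the component of multidegree [c], [split_sec c] is a section of
   [split_eps], and [split_htp c] contracts the path
   x^(a-i) y^i - ... - x^(a-m) y^m, m = min(a, c(y)), onto its end. *)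
Definition split_sec c (b : bset B) : {ffun split_set -> K^o} :=
  split_gen b (minn (bsh b x) (c y)).

Definition split_htp c (e : split_set) : {ffun split_set -> K^o} :=
  match tagged e with
  | inl i => \sum_(i <= t < minn (bsh (tag e) x) (c y)) split_syz (tag e) t
  | inr _ => 0
  end.

Lemma split_htp_gen c b i : (i <= bsh b x)%N ->
  lin (split_htp c) (split_gen b i) =
  \sum_(i <= t < minn (bsh b x) (c y)) split_syz b t.
Proof. by move=> ib; rewrite lin_split_gen // /split_htp /= inordK. Qed.

Lemma split_htp_syz c b t : lin (split_htp c) (split_syz b t) = 0.
Proof.
rewrite /split_syz; case: insubP => [o _ _|_]; last by rewrite linear0.
by rewrite lin_ebasis.
Qed.

Lemma split_eps_gen b i : lin split_eps (split_gen b i) = ebasis K b.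
Proof. by rewrite lin_ebasis. Qed.

Lemma split_eps_syz b t : lin split_eps (split_syz b t) = 0.
Proof.
rewrite /split_syz; case: insubP => [o _ _|_]; last by rewrite linear0.
by rewrite lin_ebasis.
Qed.

Lemma split_eps_chain e : lin split_eps (split_dif e) = lin (@bdif B) (split_eps e).
Proof.
case: e => b [i|t]; rewrite /split_dif {2}/split_eps /=.
  rewrite (linear_lin (lin split_eps)) lin_ebasis -[RHS]lin_ebasis_id.
  by apply: eq_lin => b' _; exact: split_eps_gen.
rewrite !linearB /= !split_eps_gen subrr sub0r linear0.
rewrite (linear_lin (lin split_eps)) /lin big1 ?oppr0 // => b' _.
by rewrite /= split_eps_syz scaler0.
Qed.

Lemma split_sec_chain c b :
  lin split_dif (split_sec c b) = lin (split_sec c) (bdif b).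
Proof.
rewrite split_dif_gen ?geq_minl //; apply: eq_lin => b' /bdif_shx le.
by rewrite /split_sec; congr split_gen; rewrite minnC minnA (minn_idPl le).
Qed.

Lemma sum_split_gen b i m : (i <= m)%N ->
  \sum_(i <= t < m) (split_gen b t.+1 - split_gen b t) = split_gen b m - split_gen b i.
Proof. by move=> im; rewrite telescope_sumr. Qed.

(** On g_i the vertical terms telescope to g_m - g_i. The horizontal terms cancel because the path
    over a smaller exponent has the same steps up to its own end, and its later steps are 0. On s_t
    the two sums differ by their first term s_t. That [e] lies below [c] enters through i <= c(y),
    respectively t < c(y), which keeps the indices within the path. *)
Lemma split_htpE c e : (bsh (e : bset split_cplx) <= c)%MM ->
  lin split_dif (split_htp c e) + lin (split_htp c) (split_dif e) =
  lin (split_sec c) (split_eps e) - ebasis K e.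
Proof.
case: e => b [i|t].
  rewrite (@split_inl_le b i) => /and3P[_ _ ic].
  have ib : (i <= bsh b x)%N by rewrite -ltnS.
  have im : (i <= minn (bsh b x) (c y))%N by rewrite leq_min ib.
  rewrite /split_eps /split_htp /split_dif /= lin_ebasis.
  set m := minn _ _; rewrite linear_sum /=.
  have -> : ebasis K (existT _ b (inl i)) = split_gen b i.
    by congr ebasis; congr existT; congr inl; apply: val_inj; rewrite /= inordK.
  rewrite -/(split_sec c b) -(@sum_split_gen b i m) //.
  rewrite (eq_big_nat _ _ (F2 := fun t => split_gen b t.+1 - split_gen b t
      - lin (fun b' => split_syz b' t) (bdif b))); last first.
    move=> t /andP[_ tm]; rewrite split_dif_syz //.
    by apply: leq_trans tm _; apply: geq_minl.
  rewrite sumrB -addrA -[RHS]addr0; congr (_ + _).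
  apply/eqP; rewrite addrC subr_eq0; apply/eqP.
  rewrite -lin_sum (linear_lin (lin (split_htp c))); apply: eq_lin => b' /bdif_shx le /=.
  rewrite [LHS]split_htp_gen ?geq_minr //.
  have [ia'|/ltnW a'i] := leqP i (bsh b' x); last first.
    rewrite [LHS]big_geq ?geq_minl // big_nat big1 // => t /andP[it _].
    by rewrite split_syz_ge // (leq_trans a'i).
  have le_m : (minn (bsh b' x) (c y) <= m)%N by rewrite leq_min geq_minr andbT (leq_trans (geq_minl _ _)).
  rewrite (@big_cat_nat _ _ _ (minn (bsh b' x) (c y)) i m) //= ?leq_min ?ia' //.
  rewrite [X in _ = _ + X]big_nat [X in _ = _ + X]big1 ?addr0 // => t.
  case/andP; rewrite geq_min => /orP[le' _|cy_t]; first by rewrite split_syz_ge.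
  by rewrite ltnNge (leq_trans (geq_minr _ _) cy_t).
rewrite (@split_inr_le b t) => /and3P[_ _ tc].
have tb := ltn_ord t; have tm : (t < minn (bsh b x) (c y))%N by rewrite leq_min tb.
rewrite /split_eps /split_htp /split_dif /= !linear0 !add0r !linearB /=.
rewrite !split_htp_gen ?(ltnW tb) // (linear_lin (lin (split_htp c))) /=.
rewrite [X in _ - X](_ : _ = 0) ?subr0; last first.
  by rewrite /lin big1 // => b' _; rewrite [X in _ *: X]split_htp_syz scaler0.
rewrite [X in _ - X]big_ltn // opprD addrCA subrr addr0.
by rewrite split_syz_lt.
Qed.

Lemma split_htpE_lin c v : bbelow (B := split_cplx) c v ->
  lin split_dif (lin (split_htp c) v) + lin (split_htp c) (lin split_dif v) =
  lin (split_sec c) (lin split_eps v) - v.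
Proof.
move=> bv; rewrite !linear_lin -linD -[X in _ - X](lin_ebasis_id v) -linB.
by apply: eq_lin => e /bv/split_htpE.
Qed.

(** At i = min(a, c(y)) the power of x left over is 0 or a - c(y), and the latter is at most c(x)
    because a <= c(x) + c(y). *)
Lemma split_sec_below c z : bbelow (split_kap c) z ->
  bbelow (B := split_cplx) c (lin (split_sec c) z).
Proof.
move=> bz e /lin_neq0[b /bz]; rewrite split_kap_le // => /andP[off le].
move=> /split_gen_neq0[|o oE ->]; first exact: geq_minl.
rewrite split_inl_le off oE geq_minr andbT /=.
by case: (leqP (bsh b x)) => _; [rewrite subnn | rewrite leq_subLR addnC].
Qed.

Lemma split_htp_below c v : bbelow (B := split_cplx) c v ->
  bbelow (B := split_cplx) c (lin (split_htp c) v).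
Proof.
move=> bv e /lin_neq0[[b [i|t]] /bv]; last by rewrite ffunE eqxx.
rewrite (@split_inl_le b i) /split_htp /= => /and3P[off ix iy].
rewrite sum_ffunE => nz.
have [t /andP[it tm] /split_syz_neq0[o oE ->]] :
    exists2 t, (i <= t < minn (bsh b x) (c y))%N & split_syz b t e != 0.
  apply: contra_notP (negP nz) => no; rewrite big_nat big1 // => t tP.
  by apply/eqP; apply: contra_notT no => nzt; exists t.
rewrite split_inr_le off oE /= (leq_trans _ ix) ?leq_sub2l //=.
by apply: leq_trans tm _; apply: geq_minr.
Qed.

Lemma split_expands : @expands split_kap split_cplx B split_eps.
Proof.
split.
- exact: split_kap_mono.
- case=> b [i|t] b'; rewrite /split_eps /=; last by rewrite ffunE eqxx.
  move=> /ebasis_neq0->; split=> //; rewrite split_kap_le //; apply/andP; split.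
    apply/forallP => z; rewrite mnmDE mnmBE !mulmnE !mnm1E ![_ == z]eq_sym.
    by case: eqP => //= _; case: eqP => //= _; rewrite !mul0n subn0 addn0.
  rewrite !mnmDE !mnmBE !mulmnE !mnm1E !eqxx (negPf xy) eq_sym (negPf xy).
  by rewrite !mul1n !mul0n B_y subn0 add0n addn0 -leq_subLR subKn // -ltnS.
- exact: split_eps_chain.
- move=> c v z bv v0 bz ez.
  have secz : lin (split_sec c) (lin (@bdif B) z) = lin split_dif (lin (split_sec c) z).
    by rewrite !linear_lin; apply: eq_lin => b _; rewrite [RHS]split_sec_chain.
  have := split_htpE_lin bv; rewrite ez secz v0 linear0 addr0 => E.
  (* For the cycle [v], the homotopy formula just obtained expresses d of the homotopy at [v] as d
     of the section at [z], minus [v]. *)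
  exists (lin (split_sec c) z - lin (split_htp c) v).
    move=> e nz; have [/(split_sec_below bz) //|] := boolP (lin (split_sec c) z e != 0).
    rewrite negbK => /eqP z0; apply: (split_htp_below bv).
    by apply: contra nz => /eqP h0; rewrite !ffunE z0 h0 subrr.
  by rewrite linearB /= [X in _ - X]E subKr.
- move=> c j z bz pz; exists (lin (split_sec c) z); split.
  + exact: split_sec_below.
  + by move=> e /lin_neq0[b /pz hb /split_gen_neq0[|o _ ->] //]; exact: geq_minl.
  + rewrite linear_lin -[RHS]lin_ebasis_id; apply: eq_lin => b _.
    exact: split_eps_gen.
Qed.

End Split.

Fixpoint splits (l : seq ('I_N * 'I_N)) (B : bcplx) : bcplx :=
  if l is xy :: l' then splits l' (split_cplx xy.1 xy.2 B) else B.

Fixpoint splits_kap (l : seq ('I_N * 'I_N)) c : 'X_{1..N} :=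
  if l is xy :: l' then split_kap xy.1 xy.2 (splits_kap l' c) else c.

(** New variables are pairwise distinct and nothing is ever split off them; so each is still absent
    from all shifts when its turn comes. *)
Definition fresh (l : seq ('I_N * 'I_N)) : bool :=
  uniq (unzip2 l) && all (fun xy => xy.1 \notin unzip2 l) l.

Lemma splits_expands l B : fresh l -> bminimal B ->
    (forall b : bset B, forall y, y \in unzip2 l -> bsh b y = 0%N) ->
  bminimal (splits l B) /\ exists eps, @expands (splits_kap l) (splits l B) B eps.
Proof.
elim: l B => [|[x y] l IHl] B /=.
  by move=> _ minB _; split=> //; eexists; apply: expands_refl.
move=> /andP[/=/andP[yl ul] /andP[xyl al]] minB By.
move: xyl; rewrite inE negb_or => /andP[xy xl].
have Byy (b : bset B) : bsh b y = 0%N by apply: By; rewrite mem_head.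
have al' : all (fun xy => xy.1 \notin unzip2 l) l.
  by apply: sub_all al => z; rewrite inE negb_or => /andP[].
have [|e z zl|min' [eps epsP]] := IHl (split_cplx x y B) _ (split_minimal x y minB).
- by rewrite /fresh ul al'.
- rewrite split_sh_other ?By ?inE ?zl ?orbT //.
    by apply: contraNneq xl => <-.
  by apply: contraNneq yl => <-.
- split=> //; eexists.
  exact: (expands_trans epsP (split_expands xy minB Byy)).
Qed.

Lemma splits_kapE l c z : fresh l ->
  splits_kap l c z = (c z + \sum_(xy <- l | xy.1 == z) c xy.2)%N.
Proof.
elim: l z => [|[x y] l IHl] z /=; first by rewrite big_nil addn0.
move=> /andP[/=/andP[yl ul] /andP[xyl al]].
move: xyl; rewrite inE negb_or => /andP[xy xl].
have fl : fresh l.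
  rewrite /fresh ul; apply: sub_all al => w.
  by rewrite inE negb_or => /andP[].
rewrite mnmDE mulmnE mnm1E big_cons /= !IHl //.
have -> : (\sum_(xy0 <- l | xy0.1 == y) c xy0.2 = 0)%N.
  rewrite big_seq_cond big_pred0 // => w; apply/andP => -[wl /eqP wy].
  by have /allP/(_ w wl) := al; rewrite wy inE eqxx.
by rewrite addn0; case: eqP => _; rewrite ?mul1n ?mul0n ?addn0 // -addnA [(c y + _)%N]addnC.
Qed.

End BasedComplexes.

(** * The ideals (x^a)^* *)

Section StarIdeals.
Variables (K : fieldType) (n : nat) (e : 'I_n -> nat).
Local Notation N := (nvars e).
Local Notation Sstar := {mpoly K[N]}.

Definition xidx (j : 'I_n) (k : 'I_(e j)) : 'I_N :=
  enum_rank (Tagged (fun j => 'I_(e j)) k).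

Definition collapse (c : 'X_{1..N}) : 'X_{1..n} :=
  [multinom (\sum_(k < e j) c (xidx k))%N | j < n].

Lemma collapseD c c' : collapse (c + c') = (collapse c + collapse c')%MM.
Proof.
apply/mnmP => j; rewrite mnmDE !mnmE -big_split; apply: eq_bigr => k _.
exact: mnmDE.
Qed.

Definition monomials_in (P : pred 'X_{1..N}) (f : Sstar) : Prop :=
  forall c, c \in msupp f -> P c.

Lemma monomials_in_ideal (P : pred 'X_{1..N}) :
  (forall c c', P c -> P (c' + c)%MM) -> is_ideal (monomials_in P).
Proof.
move=> Pmul; split=> [c|p f g Pf Pg c]; first by rewrite msupp0.
move=> /msuppD_le; rewrite mem_cat => /orP[/msuppM_le|/Pg//].
by move=> /allpairsP[[c1 c2] /= [_ /Pf Pc2 ->]]; apply: Pmul.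
Qed.

Lemma ideal_mul_sub (R : comNzRingType) (I J L : R -> Prop) : is_ideal L ->
  (forall f g, I f -> J g -> L (f * g)) -> forall f, ideal_mul I J f -> L f.
Proof.
move=> idL IJL; apply: ideal_gen_sub => // _ [f [g [If Jg ->]]]; exact: IJL.
Qed.

Lemma ideal_mul_in (R : comNzRingType) (I J : R -> Prop) f g :
  I f -> J g -> ideal_mul I J (f * g).
Proof. by move=> If Jg; apply: ideal_gen_in; exists f, g. Qed.

Lemma primeP_exp_monomials (j : 'I_n) a (f : Sstar) :
  ideal_exp (@Defs.primeP K n e j) a f -> monomials_in (fun c => (a <= collapse c j)%N) f.
Proof.
have idM b : is_ideal (monomials_in (fun c => (b <= collapse c j)%N)).
  apply: monomials_in_ideal => c c' le.
  by rewrite collapseD mnmDE (leq_trans le) ?leq_addl.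
elim: a f => [|a IHa] f; first by [].
apply: ideal_mul_sub => // {}f g fP /IHa gP.
have f1 : monomials_in (fun c => (1 <= collapse c j)%N) f.
  move: f fP; apply: ideal_gen_sub => // _ [k ->] c.
  rewrite msuppX inE => /eqP->; rewrite mnmE (bigD1 k) //= mnm1E /xidx eqxx.
  exact: leq_addr.
move=> c /msuppM_le /allpairsP[[c1 c2] /= [/f1 le1 /gP le2 ->]].
by rewrite collapseD mnmDE -addn1 addnC leq_add.
Qed.

Lemma monomial_primeP_exp (j : 'I_n) a (c : 'X_{1..N}) : (a <= collapse c j)%N ->
  ideal_exp (@Defs.primeP K n e j) a 'X_[c].
Proof.
elim: a c => [|a IHa] c le; first by [].
have [k ck] : exists k : 'I_(e j), c (xidx k) != 0%N.
  apply/existsP; rewrite -negb_forall; apply/negP => /forallP c0.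
  move: le; rewrite mnmE big1 // => k _; exact/eqP.
have cE : c = (U_(xidx k) + (c - U_(xidx k)))%MM by rewrite addmC submK // lep1mP.
rewrite cE mpolyXD; apply: ideal_mul_in; first by apply: ideal_gen_in; exists k.
apply: IHa; have : (a < collapse (U_(xidx k) + (c - U_(xidx k)))%MM j)%N by rewrite -cE.
rewrite collapseD mnmDE; suff -> : collapse U_(xidx k)%MM j = 1%N by [].
rewrite mnmE (bigD1 k) //= mnm1E eqxx big1 ?addn0 // => k' neq.
rewrite mnm1E /xidx (inj_eq enum_rank_inj) eq_Tagged /= eq_sym.
by rewrite (negPf neq).
Qed.

Definition block (c : 'X_{1..N}) (j : 'I_n) : 'X_{1..N} :=
  [multinom if tag (enum_val i) == j then c i else 0%N | i < N].

Lemma block_sum c : c = (\sum_(j < n) block c j)%MM.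
Proof.
apply/mnmP => i; rewrite mnm_sumE (bigD1 (tag (enum_val i))) //= mnmE eqxx.
by rewrite big1 ?addn0 // => j; rewrite eq_sym mnmE => /negPf->.
Qed.

Lemma collapse_block c j : collapse (block c j) j = collapse c j.
Proof. by rewrite !mnmE; apply: eq_bigr => k _; rewrite mnmE enum_rankK eqxx. Qed.

(** A power of P_j is spanned by the monomials of sufficient degree in the variables x_jk, and a
    monomial is the product of its blocks; membership can thus be tested on the block degrees alone,
    which form [collapse c]. *)
Lemma star_idealP a (f : Sstar) :
  star_ideal a f <-> monomials_in (fun c => a <= collapse c)%MM f.
Proof.
split.
  move=> fa c cf; apply/mnm_lepP => j.
  apply: (@primeP_exp_monomials j (a j) f) => //.
  move: (f) fa; rewrite /star_ideal.
  have : j \in index_enum 'I_n by rewrite mem_index_enum.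
  elim: (index_enum _) => // i r IHr; rewrite inE big_cons.
  have idj := ideal_exp_ideal (@Defs.primeP K n e j) (a j).
  case: eqP => [<- _|_ /IHr sub] g; apply: ideal_mul_sub => // x y Ix Jy.
    by rewrite mulrC -[_ * _]addr0; apply: idj.2 => //; apply: idj.1.
  by rewrite -[_ * _]addr0; apply: idj.2; [apply: sub | apply: idj.1].
move=> fa; have idS := star_ideal_ideal K e a.
have mono c : (a <= collapse c)%MM -> star_ideal (K := K) a 'X_[c].
  move=> le; rewrite (block_sum c) (big_morph _ (@mpolyXD N K) (@mpolyX0 N K)) /star_ideal.
  elim/big_ind2: _ => // [|j _].
    by move=> ? ? ? ?; apply: ideal_mul_in.
  by apply: monomial_primeP_exp; rewrite collapse_block; move/mnm_lepP: le.
rewrite (mpolyE f) big_seq; elim/big_ind: _ => [|g h Ig Ih|c /fa/mono Sc].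
- exact: idS.1.
- by rewrite -[g]mul1r; apply: idS.2.
- by rewrite -mul_mpolyC -[_ * _]addr0; apply: idS.2 => //; apply: idS.1.
Qed.

End StarIdeals.

(** * Resolutions with a finite basis *)

Section GradedOfMultigraded.
Variables (K : fieldType) (n : nat).
Local Notation S := {mpoly K[n]}.
Variables (M : grmod K n) (F : mgcplx M).

Definition mgcplx_gr : gr_free_cplx M :=
  @GrFreeCplx K n M (mgcplx_free F) (fun i v => mdeg (@shift _ (mgterm F i) v)).

Lemma mdegBE (a b : 'X_{1..n}) : (b <= a)%MM -> mdeg (a - b) = (mdeg a - mdeg b)%N.
Proof. by move=> le_ba; rewrite -{2}(submK le_ba) mdegD addnK. Qed.

Lemma mdeg_mono (a b : 'X_{1..n}) : (b <= a)%MM -> (mdeg b <= mdeg a)%N.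
Proof. by move=> le_ba; rewrite -(submK le_ba) mdegD leq_addl. Qed.

Lemma homog_in_monomial (c : K) (a b : 'X_{1..n}) :
  (~~ (b <= a)%MM -> c = 0) -> homog_in (mdeg a) (mdeg b) (c *: 'X_[(a - b)%MM] : S).
Proof.
have [le_ba _|_ c0] := boolP (b <= a)%MM; last by left; rewrite c0 ?scale0r.
right; split; first exact: mdeg_mono.
by apply: dhomogZ; rewrite dhomogX /= mdegBE.
Qed.

Lemma homog_inD D d (p q : S) : homog_in D d p -> homog_in D d q -> homog_in D d (p + q).
Proof.
move=> [->|[le hp]]; first by rewrite add0r.
move=> [->|[_ hq]]; first by rewrite addr0; right.
by right; split=> //; apply: dhomogD.
Qed.

Lemma mgcplx_gr_min : is_min_mgresolution F -> is_min_gr_free_resolution mgcplx_gr.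
Proof.
move=> [resF homF minF]; split=> //; split=> [v|i u v].
  exists [:: aug mgcplx_gr (delta_mx 0 v)]; split; last by rewrite big_seq1.
  move=> y; rewrite inE => /eqP->; exists (shift v) => //; exact: homF.
rewrite /= mxE; apply: homog_in_monomial; exact: coef_eq0.
Qed.

(** For [M] this comes from the directness of its grading, for an expansion from the construction of
    its resolution. *)
Definition lifts_multidegrees : Prop := forall d y, mgcomp d y ->
  exists2 l : 'rV_(mgrank (mgterm F 0)), below d l & mgaug F (unstrand d l) = y.

Lemma mgcplx_gr_lifts : lifts_multidegrees -> lifts_degrees mgcplx_gr.
Proof.
move=> liF k x [s [sk ->]].
elim: s sk => [|y s IHs] sk.
  exists 0; last by rewrite big_nil raddf0.
  by move=> v; left; rewrite mxE.
have [|c hc augc] := IHs.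
  by move=> z zs; apply: sk; rewrite inE zs orbT.
have [a ak ya] := sk _ (mem_head _ _).
have [l bl lE] := liF _ _ ya.
exists (unstrand a l + c); last by rewrite big_cons raddfD /= lE augc.
move=> v; rewrite mxE; apply: homog_inD => //.
by rewrite mxE -ak; apply: homog_in_monomial; apply: bl.
Qed.

Lemma betti_mgcplx : is_min_mgresolution F -> lifts_multidegrees ->
  forall (j : nat) k, betti M j k =
    #|[set v : 'I_(mgrank (mgterm F j)) | (mdeg (shift v))%:Z == k]|.
Proof.
move=> minF liF j k.
exact: (betti_count (mgcplx_gr_min minF) (mgcplx_gr_lifts liF)).
Qed.

End GradedOfMultigraded.

Section FromBased.
Variables (K : fieldType) (N : nat) (B : bcplx K N).
Hypothesis minB : bminimal B.

Definition bterm (j : nat) : mgfree N :=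
  @MgFree N #|[pred b : bset B | bhd b == j]| (fun u => bsh (enum_val u)).

Lemma bhom_eq0 j (u : 'I_(mgrank (bterm j.+1))) (v : 'I_(mgrank (bterm j))) :
  ~~ (shift v <= shift u)%MM ->
  (\matrix_(u, v) (bdif (enum_val u) (enum_val v) : K) : 'M_(mgrank (bterm j.+1), mgrank (bterm j))) u v = 0.
Proof. by move=> nle; rewrite mxE; apply: contraNeq nle => /minB.1[]. Qed.

Definition bhom j : mghom K (bterm j.+1) (bterm j) := MgHom (@bhom_eq0 j).

Definition tofun j (l : 'rV[K]_(mgrank (bterm j))) : {ffun bset B -> K^o} :=
  \sum_u l 0 u *: ebasis K (enum_val u).

Definition torow j (v : {ffun bset B -> K^o}) : 'rV[K]_(mgrank (bterm j)) :=
  \row_u (v (enum_val u) : K).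

Lemma tofunE j l u : @tofun j l (enum_val u) = l 0 u.
Proof.
rewrite /tofun sum_ffunE (bigD1 u) //= big1 ?addr0.
  by rewrite !ffunE eqxx; exact: mulr1.
move=> v neq; rewrite !ffunE (inj_eq enum_val_inj) eq_sym (negPf neq); exact: mulr0.
Qed.

Lemma tofunK j : cancel (@tofun j) (@torow j).
Proof. by move=> l; apply/rowP => u; rewrite mxE tofunE. Qed.

Lemma bpure_tofun j l : bpure j (@tofun j l).
Proof.
move=> b nz; apply/eqP; apply: contraNT nz => hb.
rewrite /tofun sum_ffunE big1 // => u _; rewrite !ffunE.
have := enum_valP u; rewrite inE => hu.
by case: eqP => [E|_]; [rewrite E hu in hb | exact: mulr0].
Qed.

Lemma torowK j v : bpure j v -> tofun (torow j v) = v.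
Proof.
move=> pv; apply/ffunP => b; have [hb|hb] := eqVneq (bhd b) j.
  have bj : b \in [pred b : bset B | bhd b == j] by rewrite inE hb.
  by rewrite -(enum_rankK_in bj bj) tofunE mxE.
transitivity (0 : K); last by apply/esym/eqP; apply: contraNT hb => /pv->.
by apply/eqP; apply: contraNT hb => /bpure_tofun->.
Qed.

Lemma below_torow j c v : bbelow c v -> below c (torow j v).
Proof. by move=> bv u; rewrite mxE; apply: contraNeq => /bv. Qed.

Lemma bbelow_tofun j c l : below c l -> bbelow c (@tofun j l).
Proof.
move=> bl b nz; have hb := bpure_tofun nz.
have bj : b \in [pred b : bset B | bhd b == j] by rewrite inE hb.
move: nz; rewrite -(enum_rankK_in bj bj) tofunE => nz.
by apply: contraNT nz => nle; rewrite bl.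
Qed.

Lemma torow_bdif j w : torow j (lin (@bdif _ _ B) w) = torow j.+1 w *m coef (bhom j).
Proof.
apply/rowP => v; rewrite !mxE /lin sum_ffunE.
rewrite (bigID [pred b : bset B | bhd b == j.+1]) /= [X in _ + X]big1 ?addr0.
  rewrite (big_enum_val (A := [pred b : bset B | bhd b == j.+1])).
  by apply: eq_bigr => u _; rewrite !mxE ffunE.
move=> b hb; rewrite ffunE; suff -> : bdif b (enum_val v) = 0 by exact: mulr0.
have := enum_valP v; rewrite inE => /eqP hv.
by apply/eqP; apply: contraNT hb => /minB.1[-> _ _]; rewrite hv.
Qed.

Lemma bpure_bdif j v : bpure j.+1 v -> bpure j (lin (@bdif _ _ B) v).
Proof. by move=> pv b /lin_neq0[b' /pv hb' /minB.1[]]; rewrite hb' => -[]. Qed.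

Lemma bdif_pure0 v : bpure 0 v -> lin (@bdif _ _ B) v = 0.
Proof.
move=> pv; rewrite /lin big1 // => b _.
have [->|/pv hb] := eqVneq (v b) 0; first by rewrite scale0r.
suff -> : bdif b = 0 by rewrite scaler0.
apply/ffunP => b'; rewrite [RHS]ffunE; apply/eqP.
by apply: contraT => /minB.1[]; rewrite hb.
Qed.

Lemma coef_bhomK j : coef (bhom j.+1) *m coef (bhom j) = 0.
Proof.
apply/row_matrixP => u; rewrite row0.
rewrite row_mul -[row u _](tofunK (j := j.+1)) -torow_bdif.
have -> : tofun (row u (coef (bhom j.+1))) = bdif (enum_val u).
  rewrite -(torowK (j := j.+1) (v := bdif (enum_val u))).
    by congr tofun; apply/rowP => v; rewrite !mxE.
  move=> b /minB.1[hb _ _]; have /eqP := enum_valP u; rewrite hb.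
  by case.
by rewrite minB.2; apply/rowP => v; rewrite !mxE ffunE.
Qed.

Definition bexact : Prop := forall c j v, bbelow c v -> bpure j.+1 v ->
  lin (@bdif _ _ B) v = 0 -> exists2 w, bbelow c w & v = lin (@bdif _ _ B) w.

Lemma bhom_exact : bexact -> forall j (c : 'rV_(mgrank (bterm j.+1))),
  c *m mghom_mx (bhom j) = 0 <-> exists b, c = b *m mghom_mx (bhom j.+1).
Proof.
move=> exB j; apply: exact_of_strands; first exact: coef_bhomK.
move=> d l bl l0; have [|w bw wE] := exB _ _ _ (bbelow_tofun bl) (@bpure_tofun _ l).
  rewrite -(torowK (bpure_bdif (@bpure_tofun _ l))) torow_bdif tofunK l0.
  by rewrite /tofun big1 // => u _; rewrite mxE scale0r.
exists (torow j.+2 w); first exact: below_torow.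
by rewrite -torow_bdif -wE tofunK.
Qed.

Lemma bhom_minimal j u v : maxideal (mghom_mx (bhom j) u v).
Proof.
rewrite mxE; have [->|nz] := eqVneq (coef (bhom j) u v) 0.
  rewrite scale0r; exists [::]; split=> //; by rewrite big_nil.
apply: maxideal_mpolyX; move: nz; rewrite mxE => /minB.1[_ le lt].
by rewrite -mdeg_eq0 mdegBE // subn_eq0 -ltnNge.
Qed.

End FromBased.

(** * Splitting all variables *)

Section Presentations.
Variables (K : fieldType) (n : nat).

(* The component of multidegree [d] of [B] resolves the cokernel of the
   component of multidegree [d] of [phi], via [lam : B_0 -> G0]. *)
Record resolves_coker (B : bcplx K n) (G1 G0 : mgfree n) (phi : mghom K G1 G0)
    (lam : bset B -> 'rV[K]_(mgrank G0)) : Prop := ResolvesCoker {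
  resolves_minimal : bminimal B;
  resolves_higher : bexact B;
  resolves_degree : forall b v, lam b 0 v != 0 -> (shift v <= bsh b)%MM;
  resolves_zero : forall b, exists2 z : 'rV_(mgrank G1),
    below (bsh b) z & lin lam (bdif b) = z *m coef phi;
  resolves_kernel : forall d v z, bbelow d v -> bpure 0 v -> below d z ->
    lin lam v = z *m coef phi -> exists2 w, bbelow d w & v = lin (@bdif _ _ B) w;
  resolves_onto : forall d (y : 'rV_(mgrank G0)), below d y -> exists v z,
    [/\ bbelow d v, bpure 0 v, below d z & y = lin lam v + z *m coef phi] }.
End Presentations.

(** * The polynomial ring S inside S^* on the first variables of the blocks *)

Section Expanded.
Variables (K : fieldType) (n : nat) (e : 'I_n -> nat).
Hypothesis e_gt0 : forall k, (0 < e k)%N.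
Local Notation N := (nvars e).
Local Notation Sstar := {mpoly K[N]}.
Local Notation pairs := {j : 'I_n & 'I_(e j)}.

Definition first_var (j : 'I_n) : 'I_N := xidx (Ordinal (e_gt0 j)).

(* each [x_jk], k > 0, is split off [x_j0] *)
Definition split_pairs : seq pairs :=
  filter (fun p : pairs => tagged p != Ordinal (e_gt0 (tag p))) (enum {: pairs}).

Definition all_splits : seq ('I_N * 'I_N) :=
  [seq (first_var (tag p), xidx (tagged p)) | p : pairs <- split_pairs].

Lemma xidx_inj (p q : {j : 'I_n & 'I_(e j)}) :
  xidx (tagged p) = xidx (tagged q) -> p = q.
Proof. by case: p q => [j k] [j' k'] /enum_rank_inj. Qed.

Lemma all_splits_fresh : fresh all_splits.
Proof.
have snd : unzip2 all_splits = [seq xidx (tagged p) | p : pairs <- split_pairs].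
  by rewrite /unzip2 /all_splits -map_comp.
rewrite /fresh snd; apply/andP; split.
  rewrite map_inj_in_uniq; first exact/filter_uniq/enum_uniq.
  by move=> p q _ _; apply: xidx_inj.
apply/allP => _ /mapP[p _ ->] /=; apply/mapP => -[q].
rewrite mem_filter => /andP[q0 _] E.
have pq : Tagged (fun j => 'I_(e j)) (Ordinal (e_gt0 (tag p))) = q.
  exact: xidx_inj.
by move: q0; rewrite -pq /=; case/eqP.
Qed.

(** The exponent of x_j is placed on x_j0, which exists because [e j] is positive. *)
Definition iota_mnm (a : 'X_{1..n}) : 'X_{1..N} :=
  [multinom if tagged (enum_val i) == Ordinal (e_gt0 (tag (enum_val i)))
            then a (tag (enum_val i)) else 0%N | i < N].

Lemma iota_first a j : iota_mnm a (first_var j) = a j.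
Proof. by rewrite mnmE /first_var enum_rankK /= ?eqxx. Qed.

Lemma iota_split a y : y \in unzip2 all_splits -> iota_mnm a y = 0%N.
Proof.
rewrite /unzip2 -map_comp => /mapP[p]; rewrite mem_filter => /andP[p0 _] ->.
rewrite mnmE /xidx /= enum_rankK /=; case: p p0 => j k /= k0.
by rewrite (negPf k0).
Qed.

Lemma big_xidx (V : nmodType) (F : 'I_N -> V) :
  \sum_i F i = \sum_(j < n) \sum_(k < e j) F (xidx k).
Proof.
rewrite sig_big_dep /= (reindex (fun p : {j : 'I_n & 'I_(e j)} => xidx (tagged p))).
  by [].
apply: onW_bij; exists (fun i : 'I_N => (enum_val i : pairs)) => [p|i].
  by rewrite /xidx enum_rankK; case: p.
rewrite /xidx -[RHS]enum_valK; congr enum_rank.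
by case: (enum_val i).
Qed.

Lemma mdeg_iota a : mdeg (iota_mnm a) = mdeg a.
Proof.
rewrite !mdegE (big_xidx (V := nat) (fun i => iota_mnm a i)); apply: eq_bigr => j _.
rewrite (bigD1 (Ordinal (e_gt0 j))) //= -/(first_var j) iota_first.
rewrite big1 => [|k k0]; first exact: addn0.
rewrite mnmE /xidx enum_rankK /=.
by rewrite (negPf k0).
Qed.

Lemma iota_mono a b : (a <= b)%MM -> (iota_mnm a <= iota_mnm b)%MM.
Proof.
by move=> /mnm_lepP le; apply/mnm_lepP => i; rewrite !mnmE; case: ifP.
Qed.

Lemma first_var_inj : injective first_var.
Proof.
move=> i j E.
by have := @xidx_inj (Tagged _ (Ordinal (e_gt0 i))) (Tagged _ (Ordinal (e_gt0 j))) E => -[].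
Qed.

Lemma splits_kap_collapse c j : splits_kap all_splits c (first_var j) = collapse c j.
Proof.
rewrite splits_kapE ?all_splits_fresh // mnmE.
rewrite [RHS](bigD1 (Ordinal (e_gt0 j))) //= -/(first_var j); congr (_ + _)%N.
rewrite big_map big_filter_cond /= big_enum_cond /=.
transitivity (\sum_(i < n | i == j) \sum_(k < e i | k != Ordinal (e_gt0 i)) c (xidx k))%N.
  rewrite sig_big_dep; apply: eq_bigl => p /=.
  by rewrite (inj_eq first_var_inj) andbC.
by rewrite big_pred1_eq.
Qed.

(** At x_j0 the splittings accumulate the exponents of the whole block of j, and at all other
    variables [iota_mnm a] is 0, so that no condition arises there. *)
Lemma iota_le_kap a c : (iota_mnm a <= splits_kap all_splits c)%MM = (a <= collapse c)%MM.
Proof.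
apply/mnm_lepP/mnm_lepP => le j.
  by rewrite -splits_kap_collapse -(iota_first a).
case: (boolP (tagged (enum_val j) == Ordinal (e_gt0 (tag (enum_val j))))) => [E|nE].
  have -> : j = first_var (tag (enum_val j)).
    rewrite /first_var -(eqP E) /xidx -[LHS]enum_valK; congr enum_rank.
    by case: (enum_val j).
  by rewrite iota_first splits_kap_collapse.
by rewrite mnmE (negPf nE).
Qed.
End Expanded.

(** * Resolution of an expansion *)

Section StarModules.
Variables (K : fieldType) (n : nat) (e : 'I_n -> nat).
Local Notation N := (nvars e).
Local Notation Sstar := {mpoly K[N]}.
Implicit Types (G : mgfree n) (c : 'X_{1..N}).

(** F^* lies in the free module with the generators of F moved to multidegree 0, and phi^* is the
    restriction of a matrix of scalars between such modules; this makes the calculus of strands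
    available. *)
Definition flat G : mgfree N := @MgFree N (mgrank G) (fun _ => 0%MM).

Lemma le0mnm (m : 'X_{1..N}) : (0 <= m)%MM.
Proof. by apply/mnm_lepP => i; rewrite mnm0E. Qed.

Lemma flat_hom_eq0 (F : mgfree N) G (A : 'M[K]_(mgrank F, mgrank G)) u v :
  ~~ (@shift _ (flat G) v <= shift u)%MM -> A u v = 0.
Proof. by rewrite le0mnm. Qed.

Definition flat_hom (F : mgfree N) G (A : 'M[K]_(mgrank F, mgrank G)) :
    mghom K F (flat G) :=
  @MgHom K N F (flat G) A (@flat_hom_eq0 F G A).

Lemma star_predP G (r : 'rV[Sstar]_(mgrank G)) :
  r \in @star_pred K n e G <->
  forall c, below (F := G) (collapse c) (strand (F := flat G) c r).
Proof.
split=> [/asboolP rG c u nle|rG].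
  have /star_idealP ru := rG u.
  rewrite mxE le0mnm subm0; apply/eqP; apply: contraNT nle.
  by rewrite -mcoeff_msupp => /ru.
apply/asboolP => u; apply/star_idealP => c cu.
apply: contraLR cu => nle; rewrite mcoeff_msupp negbK; apply/eqP.
by have := rG c u nle; rewrite mxE le0mnm subm0.
Qed.

Lemma star_pred_unstrand G c (l : 'rV[K]_(mgrank G)) :
  below (F := G) (collapse c) l -> unstrand (F := flat G) c l \in @star_pred K n e G.
Proof.
move=> bl; apply/asboolP => u; apply/star_idealP => c'.
rewrite mxE subm0; have [le|nle] := boolP (shift u <= collapse c)%MM.
  by move=> /msuppZ_le; rewrite msuppX inE => /eqP->.
by rewrite bl // scale0r msupp0.
Qed.

Definition star_elem G c (l : 'rV[K]_(mgrank G)) (bl : below (F := G) (collapse c) l) :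
    starmod K e G :=
  exist _ (unstrand (F := flat G) c l) (star_pred_unstrand bl).

Lemma mgcomp_star_elem G c l bl :
  mgcomp c (@star_elem G c l bl : star_free K e G).
Proof. by move=> u; exists (l 0 u); rewrite /= mxE subm0. Qed.

Lemma mgcomp_starP G c (y : star_free K e G) : mgcomp c y ->
  exists l (bl : below (F := G) (collapse c) l), y = star_elem bl.
Proof.
move=> yc.
have sub0 : (c - 0)%MM = c by exact: subm0.
have bl := (star_predP (val y)).1 (valP y) c.
exists (strand (F := flat G) c (val y)), bl; apply: val_inj; apply/rowP => u.
by rewrite !mxE le0mnm sub0; have [l ->] := yc u; rewrite mcoeffZ mcoeffX eqxx mulr1.
Qed.

Lemma star_mxE G1 G0 (phi : mghom K G1 G0) :
  star_mx e phi = mghom_mx (@flat_hom (flat G1) G0 (coef phi)).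
Proof.
by apply/matrixP => u v; rewrite !mxE subm0 mpolyX0 alg_mpolyC.
Qed.

Lemma below_flat G c (l : 'rV[K]_(mgrank G)) : below (F := flat G) c l.
Proof. by move=> u; rewrite le0mnm. Qed.

Lemma unstrandD (F : mgfree N) c (l l' : 'rV[K]_(mgrank F)) :
  unstrand c (l + l') = unstrand c l + unstrand c l'.
Proof. by apply/rowP => u; rewrite !mxE scalerDl. Qed.

Lemma star_map_elem G1 G0 (phi : mghom K G1 G0) c z (bz : below (collapse c) z) :
  val (star_map phi (star_elem bz)) = unstrand (F := flat G0) c (z *m coef phi).
Proof.
rewrite /= star_mxE; apply: (unstrand_mul (@flat_hom (flat G1) G0 (coef phi))).
exact: below_flat.
Qed.

End StarModules.

Section ExpandedResolution.
Variables (K : fieldType) (n : nat) (e : 'I_n -> nat).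
Hypothesis e_gt0 : forall k, (0 < e k)%N.
Local Notation N := (nvars e).
Local Notation Sstar := {mpoly K[N]}.
Variables (B : bcplx K n) (G1 G0 : mgfree n) (phi : mghom K G1 G0).
Variable lam : bset B -> 'rV[K]_(mgrank G0).
Hypothesis res : resolves_coker phi lam.

Definition embed : bcplx K N :=
  @BCplx K N (bset B) (@bhd _ _ B) (fun b => iota_mnm e_gt0 (bsh b)) (@bdif _ _ B).

Definition expanded : bcplx K N := splits (all_splits e_gt0) embed.

Local Notation kap := (splits_kap (all_splits e_gt0)).

Lemma embed_minimal : bminimal embed.
Proof.
have [D1 D2] := resolves_minimal res; split=> // b b' /D1[hb sb mb].
by split=> //=; [exact: iota_mono | rewrite !mdeg_iota].
Qed.

Lemma bbelow_embed c v : bbelow (B := embed) (kap c) v <-> bbelow (B := B) (collapse c) v.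
Proof. by split=> bv b /bv; rewrite /= iota_le_kap. Qed.

Lemma lam_below d v : bbelow d v -> below d (lin lam v).
Proof.
move=> bv u nle; rewrite /lin summxE big1 // => b _; rewrite mxE.
have [->|/bv le_bd] := eqVneq (v b) 0; first by rewrite mul0r.
suff -> : lam b 0 u = 0 by rewrite mulr0.
apply/eqP; apply: contraNT nle => /(resolves_degree res) le.
exact: lepm_trans le le_bd.
Qed.

Variable eps : bset expanded -> {ffun bset embed -> K^o}.
Hypothesis minE : bminimal expanded.
Hypothesis epsP : @expands _ _ kap expanded embed eps.

Lemma expanded_exact : bexact expanded.
Proof.
move=> c j v bv pv v0.
have b1 := (bbelow_embed _ _).1 (expands_below epsP bv).
have [||w bw wE] := resolves_higher res b1 (j := j).
- by move=> b /lin_neq0[x /pv hx /(expands_degree epsP)[-> _]].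
- by have E := expands_chain_lin epsP v; apply: etrans (esym E) _; rewrite v0 linear0.
by have [w' bw' ->] := expands_exact epsP bv v0 ((bbelow_embed _ _).2 bw) wE; exists w'.
Qed.

Definition aug_mx : 'M[K]_(mgrank (bterm expanded 0), mgrank G0) :=
  \matrix_(u, v) lin lam (eps (enum_val u)) 0 v.

Lemma aug_mxE l : l *m aug_mx = lin lam (lin eps (@tofun _ _ expanded 0 l)).
Proof.
apply/rowP => v; rewrite [LHS]mxE /tofun (linear_sum (lin eps)) (linear_sum (lin lam)) summxE; apply: eq_bigr => u _.
by rewrite !linearZ /= lin_ebasis [RHS]mxE; congr (_ * _); rewrite mxE.
Qed.

Local Notation aug_hom := (flat_hom aug_mx).

Lemma eps_below c l : below c l ->
  bbelow (collapse c) (lin eps (@tofun _ _ expanded 0 l) : {ffun bset B -> K^o}).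
Proof.
move=> bl; apply/bbelow_embed; apply: (expands_below epsP).
exact: bbelow_tofun.
Qed.

Lemma eps_pure l : bpure 0 (lin eps (@tofun _ _ expanded 0 l) : {ffun bset B -> K^o}).
Proof.
by move=> b /lin_neq0[x /bpure_tofun hx /(expands_degree epsP)[-> _]].
Qed.

Lemma aug_star r : r *m mghom_mx aug_hom \in @star_pred K n e G0.
Proof.
apply/star_predP => c; rewrite (strand_mul aug_hom) /= aug_mxE.
by apply: lam_below; apply: eps_below; apply: below_strand.
Qed.

Definition star_aug (r : 'rV[Sstar]_(mgrank (bterm expanded 0))) : starmod K e G0 :=
  exist _ (r *m mghom_mx aug_hom) (aug_star r).

Lemma star_aug_linear : linear star_aug.
Proof. by move=> c x y; apply: val_inj; rewrite /= mulmxDl -scalemxAl. Qed.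

HB.instance Definition _ := GRing.isLinear.Build Sstar _ (starmod K e G0) _
  star_aug star_aug_linear.

Variables (T : grmod K N) (pi : {linear starmod K e G0 -> T}).
Hypothesis pi_onto : forall t, exists y, pi y = t.
Hypothesis pi_ker : forall y, pi y = 0 <-> exists z : starmod K e G1, star_map phi z = y.
Hypothesis pi_homog : forall c t,
  mgcomp c t <-> exists2 y : star_free K e G0, mgcomp c y & t = pi y.

(** The target [T] is any model of the cokernel of phi^*, given by [pi]; it will be both the
    expansion of [M] and, with the zero map for [phi], a module F^* itself. *)
Definition expanded_cplx : mgcplx T :=
  @MgCplx K N T (bterm expanded) (bhom minE) (pi \o star_aug).

Lemma expanded_lifts : lifts_multidegrees expanded_cplx.
Proof.
move=> c t /pi_homog[y /mgcomp_starP[l [bl ->]] ->].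
have [v [z [bv pv bz lE]]] := resolves_onto res bl.
have [w [bw pw ew]] := expands_onto epsP ((bbelow_embed _ _).2 bv) pv.
exists (torow 0 w); first exact: below_torow.
apply/esym/eqP; rewrite -subr_eq0 /= -linearB; apply/eqP/pi_ker.
exists (star_elem bz); apply: val_inj; rewrite star_map_elem.
rewrite /= (unstrand_mul aug_hom) ?aug_mxE ?(torowK pw) ?ew ?lE; last exact: below_torow.
by rewrite [X in _ = X - _]unstrandD addrC addKr.
Qed.

Lemma star_aug_strand c r : strand (F := flat e G0) c (val (star_aug r)) =
  lin lam (lin eps (@tofun _ _ expanded 0 (strand c r))).
Proof. by rewrite /= (strand_mul aug_hom) aug_mxE. Qed.

Lemma lam_bdif v : exists z : 'rV_(mgrank G1),
  lin lam (lin (@bdif _ _ B) v) = z *m coef phi /\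
  forall d, bbelow d v -> below d z.
Proof.
pose z b := projT1 (cid2 (resolves_zero res b)).
have zb b : below (bsh b) (z b) by rewrite /z; case: cid2.
have zE b : lin lam (bdif b) = z b *m coef phi by rewrite /z; case: cid2.
exists (lin z v); split.
  rewrite (linear_lin (lin lam)) /lin mulmx_suml; apply: eq_bigr => b _.
  by rewrite -scalemxAl /= zE.
move=> d bv u nle; rewrite /lin summxE big1 // => b _; rewrite mxE.
have [->|/bv le_bd] := eqVneq (v b) 0; first by rewrite mul0r.
rewrite zb ?mulr0 //; apply: contra nle => le; exact: lepm_trans le_bd.
Qed.

Lemma pi_star_aug0 (b : 'rV[Sstar]_(mgrank (bterm expanded 1))) :
  pi (star_aug (b *m mghom_mx (bhom minE 0))) = 0.
Proof.
suff aug0 u : pi (star_aug (delta_mx 0 u *m mghom_mx (bhom minE 0))) = 0.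
  pose f : {linear 'rV[Sstar]_(mgrank (bterm expanded 1)) -> T} :=
    (pi \o star_aug) \o mulmxr (mghom_mx (bhom minE 0)).
  rewrite -[LHS]/(f b) (row_sum_delta b) linear_sum big1 // => u _.
  by rewrite linearZ /= aug0 scaler0.
apply/pi_ker; set x := enum_val u.
have [z [zE bz]] := lam_bdif (eps x).
have bx : below (collapse (bsh x)) z.
  by apply: bz; apply/bbelow_embed => w /(expands_degree epsP)[].
exists (star_elem bx); apply: val_inj; rewrite star_map_elem -zE.
have E1 : delta_mx 0 u *m mghom_mx (bhom minE 0) =
    unstrand (shift u) (delta_mx 0 u *m coef (bhom minE 0)).
  by rewrite -unstrand_mul ?unstrand_delta //; apply: below_delta.
have E2 : delta_mx 0 u *m mghom_mx (bhom minE 0) *m mghom_mx aug_hom =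
    unstrand (F := flat e G0) (shift u) (delta_mx 0 u *m coef (bhom minE 0) *m aug_mx).
  by rewrite E1 (unstrand_mul aug_hom) //; apply: below_mul; apply: below_delta.
apply: etrans _ (esym E2); congr unstrand.
rewrite aug_mxE -[delta_mx 0 u]tofunK -torow_bdif torowK.
  rewrite (expands_chain_lin epsP); congr (lin lam (lin _ _)).
  rewrite /tofun (bigD1 u) //= big1 ?addr0 => [|v neq].
    by rewrite mxE !eqxx scale1r lin_ebasis.
  by rewrite mxE (negPf neq) andbF scale0r.
by apply: bpure_bdif => //; apply: bpure_tofun.
Qed.

Lemma expanded_resolution : is_min_mgresolution expanded_cplx.
Proof.
split=> [|v|i u v]; last exact: bhom_minimal.
- split=> [t|c|i c]; last exact: bhom_exact expanded_exact i c.
    have [y <-] := pi_onto t.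
    have [s [_ _ yE]] := strand_partition (F := flat e G0) (val y) [::].
    have yS d := (star_predP (val y)).1 (valP y) d.
    have -> : y = \sum_(d <- s) star_elem (yS d).
      by apply: val_inj; rewrite [RHS]raddf_sum; exact: yE.
    rewrite linear_sum; elim: s {yE} => [|d s [c cE]].
      by exists 0; rewrite big_nil raddf0.
    have [|l _ lE] := expanded_lifts (d := d) (y := pi (star_elem (yS d))).
      by apply/pi_homog; exists (star_elem (yS d)) => //; exact: mgcomp_star_elem.
    by exists (unstrand d l + c); rewrite big_cons raddfD -lE -cE.
  split=> [c0|[b ->]]; last exact: pi_star_aug0.
  apply: image_of_strands => d.
  have /pi_ker[z zE] := c0.
  have := star_aug_strand d c; rewrite -zE.
  have bz := (star_predP (val z)).1 (valP z) d.
  rewrite /= star_mxE (strand_mul (@flat_hom _ _ e (flat e G1) G0 (coef phi))) => E.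
  have bc := @below_strand _ _ (bterm expanded 0) d c.
  (* In [B] the image of the strand under [eps] is a boundary; [expands_exact] then makes the strand
     itself one. *)
  have [w bw wE] := resolves_kernel res (eps_below bc) (@eps_pure _) bz (esym E).
  have p0 := @bpure_tofun _ _ expanded 0 (strand d c).
  have [w' bw' w'E] := expands_exact epsP (bbelow_tofun bc) (bdif_pure0 minE p0) ((bbelow_embed _ _).2 bw) wE.
  exists (torow 1 w'); first exact: below_torow.
  by rewrite -(torow_bdif minE) -w'E tofunK.
- apply/pi_homog; exists (star_aug (delta_mx 0 v)) => // u.
  exists (aug_mx v u); rewrite /= -rowE !mxE subm0.
  by [].
Qed.

End ExpandedResolution.

(** * Counting generators *)

Section Counting.
Variables (K : fieldType) (N : nat).
Implicit Types (a : 'X_{1..N}) (w : nat -> 'X_{1..N} -> nat) (l : seq ('I_N * 'I_N)).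

(* The sum of [w (homological degree) (shift)] over the basis elements of a
   splitting is the sum of [split_weight w] over the original basis. *)
Definition split_weight (x y : 'I_N) w (h : nat) a : nat :=
  (\sum_(i < (a x).+1) w h (a - U_(x) *+ i + U_(y) *+ i)%MM +
   \sum_(t < a x) w h.+1 (a - U_(x) *+ t + U_(y) *+ t.+1)%MM)%N.

Fixpoint splits_weight l w : nat -> 'X_{1..N} -> nat :=
  if l is xy :: l' then split_weight xy.1 xy.2 (splits_weight l' w) else w.

Definition splits_length l a : nat := count (fun xy => a xy.1 != 0%N) l.

Lemma split_sum x y w (B : bcplx K N) :
  (\sum_(e : bset (split_cplx x y B)) w (bhd e) (bsh e) =
   \sum_(b : bset B) split_weight x y w (bhd b) (bsh b))%N.
Proof.
transitivity (\sum_(b : bset B) \sum_(o : 'I_(bsh b x).+1 + 'I_(bsh b x))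
    w (@bhd _ _ (split_cplx x y B) (existT _ b o))
      (@bsh _ _ (split_cplx x y B) (existT _ b o)))%N.
  by rewrite sig_big_dep; apply: eq_bigr => -[b o].
by apply: eq_bigr => b _; rewrite big_sumType.
Qed.

Lemma splits_sum l w (B : bcplx K N) :
  (\sum_(e : bset (splits l B)) w (bhd e) (bsh e) =
   \sum_(b : bset B) splits_weight l w (bhd b) (bsh b))%N.
Proof. by elim: l B => [|[x y] l IHl] B //=; rewrite IHl split_sum. Qed.

Lemma eq_split_weight x y w w' h h' a :
  (forall k b, w (h + k)%N b = w' (h' + k)%N b) ->
  split_weight x y w h a = split_weight x y w' h' a.
Proof.
move=> E; rewrite /split_weight; congr (_ + _)%N; apply: eq_bigr => i _.
  by have := E 0%N; rewrite !addn0 => ->.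
by have := E 1%N; rewrite !addn1 => ->.
Qed.

Lemma splits_weight_shift l w w' h h' a :
  (forall k b, w (h + k)%N b = w' (h' + k)%N b) ->
  splits_weight l w h a = splits_weight l w' h' a.
Proof.
elim: l h h' a => [|[x y] l IHl] h h' a E /=.
  by have := E 0%N a; rewrite !addn0.
apply: eq_split_weight => k b; apply: IHl => k' b'.
by rewrite -!addnA.
Qed.

Lemma splits_weight0 l h a : splits_weight l (fun _ _ => 0%N) h a = 0%N.
Proof.
elim: l h a => [|[x y] l IHl] h a //=.
by rewrite /split_weight !big1 // => i _; rewrite IHl.
Qed.

Lemma splits_length_split l x y i j a : y \notin unzip1 l ->
  (splits_length l (a - U_(x) *+ i + U_(y) *+ j)%MM <= splits_length l a)%N.
Proof.
elim: l => [|[x' y'] l IHl] //=; rewrite inE negb_or => /andP[yx' /IHl le].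
apply: leq_add le; rewrite mnmDE mnmBE !mulmnE !mnm1E (negPf yx') mul0n addn0.
by case: (a x') => [|a']; rewrite ?sub0n //; case: (_ - _)%N.
Qed.

Lemma fresh_cons xy l : fresh (xy :: l) ->
  [/\ fresh l, xy.2 \notin unzip1 l & xy.1 != xy.2].
Proof.
case: xy => x y /andP[/=/andP[yl ul] /andP[xyl al]].
move: xyl; rewrite inE negb_or => /andP[xy xl]; split=> //.
  rewrite /fresh ul; apply: sub_all al => p.
  by rewrite inE negb_or => /andP[].
apply/mapP => -[p pl yp]; have /allP/(_ p pl) := al.
by rewrite -yp inE eqxx.
Qed.

(** A generator changes neither |a| nor the homological degree; a syzygy raises both by 1 and exists
    only if x occurs in a. The difference of the two degrees is therefore invariant, and each pair
    whose source occurs can raise them at most once. *)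
Lemma splits_weight_neq0 l w h a : fresh l -> splits_weight l w h a != 0%N ->
  exists h' a', [/\ w h' a' != 0, h <= h', h' <= h + splits_length l a &
                    mdeg a' + h = mdeg a + h']%N.
Proof.
elim: l h a => [|[x y] l IHl] h a /= fl; first by exists h, a; rewrite addn0 leqnn.
have [{}/IHl IHl yl xy] := fresh_cons fl.
rewrite /split_weight addn_eq0 negb_and => /orP[] /=.
  rewrite sum_nat_eq0 negb_forall => /existsP[i /= /IHl[h' [a' [w0 hh' h'l degE]]]].
  exists h', a'; split=> //.
    apply: leq_trans h'l _; rewrite leq_add2l (leq_trans _ (leq_addl _ _)) //.
    exact: splits_length_split.
  rewrite degE mdeg_split -1?ltnS // subnK //.
  by apply: leq_trans (leq_mdeg_x _ _); rewrite -ltnS.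
rewrite sum_nat_eq0 negb_forall => /existsP[i /= /IHl[h' [a' [w0 hh' h'l degE]]]].
have ax : (i < a x)%N := ltn_ord i.
exists h', a'; split=> //; first exact: ltnW.
  apply: leq_trans h'l _; rewrite addSnnS leq_add2l -lt0n (leq_ltn_trans _ ax) //.
  by rewrite add1n ltnS splits_length_split.
have E : (mdeg a - i + i.+1 = (mdeg a).+1)%N.
  by rewrite addnS subnK // (leq_trans (ltnW ax) (leq_mdeg_x _ _)).
by move: degE; rewrite mdeg_split ?(ltnW ax) // E addnS addSn => -[].
Qed.

(** Choosing g_0 = x^a at every splitting leaves both degree and shift unchanged. *)
Lemma splits_weight_base l w h a : w h a != 0%N -> splits_weight l w h a != 0%N.
Proof.
elim: l => [|[x y] l IHl] //= /IHl nz.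
rewrite /split_weight big_ord_recl /=.
have -> : (a - U_(x) *+ 0 + U_(y) *+ 0 = a)%MM.
  by apply/mnmP => i; rewrite mnmDE mnmBE !mulmnE !muln0 subn0 addn0.
by rewrite -addnA addn_eq0 (negPf nz).
Qed.

(** Choose s_0 whenever x occurs and g_0 otherwise. The shift of s_0 is a plus that of y, still with
    x to the power a(x), so every further variable split off x raises the homological degree
    again. *)
Lemma splits_weight_length l w h a : fresh l ->
    (forall b, w (h + splits_length l a)%N b != 0%N) ->
  splits_weight l w h a != 0%N.
Proof.
elim: l h a => [|[x y] l IHl] h a fl /= wnz.
  by have := wnz a; rewrite addn0.
have [{}fl yl xy] := fresh_cons fl.
have a0E j : (a - U_(x) *+ 0 + U_(y) *+ j = a + U_(y) *+ j)%MM.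
  by apply/mnmP => i; rewrite mnmDE mnmBE mulmnE muln0 subn0 mnmDE.
rewrite /split_weight; have [ax|ax] := eqVneq (a x) 0%N.
  rewrite ax big_ord_recl /= a0E; have -> : (a + U_(y) *+ 0 = a)%MM.
    by apply/mnmP => i; rewrite mnmDE mulmnE muln0 addn0.
  rewrite -addnA addn_eq0 negb_and IHl // => b.
  by have := wnz b; rewrite ax.
rewrite addn_eq0 negb_and; apply/orP; right.
rewrite sum_nat_eq0 negb_forall; apply/existsP.
have a0 : (0 < a x)%N by rewrite lt0n.
exists (Ordinal a0) => /=; rewrite a0E; apply: IHl => // b.
have -> : splits_length l (a + U_(y) *+ 1)%MM = splits_length l a.
  apply: eq_in_count => -[x' y'] xyl /=; rewrite mnmDE mulmnE mnm1E.
  suff /negPf -> : y != x' by rewrite mul0n addn0.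
  by apply: contraNneq yl => ->; apply/mapP; exists (x', y').
by have := wnz b; rewrite ax addnA addn1.
Qed.

End Counting.

(** * The data of F and of the presentation *)

Section FreePresentation.
Variables (K : fieldType) (n : nat) (G : mgfree n).

(** A free module is the cokernel of a map from the zero module; seen this way, F_i^* is resolved by
    the same construction as M^*. *)
Definition free_base : bcplx K n :=
  @BCplx K n 'I_(mgrank G) (fun _ => 0%N) (@shift _ G) (fun _ => 0).

Definition zero_mgfree : mgfree n := @MgFree n 0 (fun _ => 0%MM).

Lemma zero_hom_eq0 u v : ~~ (shift v <= shift u)%MM ->
  (0 : 'M[K]_(mgrank zero_mgfree, mgrank G)) u v = 0.
Proof. by case: u. Qed.

Definition zero_hom : mghom K zero_mgfree G := MgHom zero_hom_eq0.

Lemma lin_delta_row (v : {ffun 'I_(mgrank G) -> K^o}) :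
  lin (fun u => delta_mx 0 u : 'rV[K]_(mgrank G)) v = \row_u (v u : K).
Proof. by rewrite [RHS]row_sum_delta; apply: eq_bigr => u _; rewrite mxE. Qed.

Lemma free_base_resolves : @resolves_coker K n free_base _ _ zero_hom
  (fun u => delta_mx 0 u).
Proof.
split=> [|d j v _ pv v0|b v|b|d v z bv pv bz|d y by_].
- by split=> [b b'|b]; [rewrite ffunE eqxx | rewrite linear0].
- exists 0; first by move=> b; rewrite ffunE eqxx.
  rewrite linear0; apply/ffunP => b; rewrite ffunE.
  by apply/eqP; apply: contraT => /pv.
- by rewrite mxE eqxx /=; case: (v =P b) => [->|]; rewrite ?lepm_refl ?eqxx.
- exists 0; first by move=> u; rewrite mxE.
  by rewrite linear0 mul0mx.
- rewrite lin_delta_row mulmx0 => E; exists 0; first by move=> b; rewrite ffunE eqxx.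
  rewrite linear0; apply/ffunP => b; rewrite ffunE.
  by have /rowP/(_ b) := E; rewrite !mxE.
- exists [ffun u => y 0 u : K^o], 0; split=> [b||u|].
  + by rewrite ffunE; apply: contraNT => nle; rewrite by_.
  + by move=> b.
  + by rewrite mxE.
  + by rewrite lin_delta_row mulmx0 addr0; apply/rowP => u; rewrite mxE ffunE.
Qed.

End FreePresentation.

(** * The finite resolution F as a based complex, compared with the presentation *)

Section ResolutionBase.
Variables (K : fieldType) (n : nat) (M : grmod K n) (p : nat) (F : mgcplx M).
Local Notation S := {mpoly K[n]}.
Hypothesis F_res : is_min_mgresolution F.
Hypothesis F_len : forall i, (p < i)%N -> mgrank (mgterm F i) = 0%N.

Definition base_set : finType := {i : 'I_p.+1 & 'I_(mgrank (mgterm F i))}.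

Definition base_elt (i : 'I_p.+1) (u : 'I_(mgrank (mgterm F i))) : base_set :=
  existT _ i u.

(* The coefficients are indexed by natural numbers, since the homological
   degrees of two basis elements are related only by a propositional equality. *)
Definition coefn (i u v : nat) : K :=
  if insub u is Some u' then
    if insub v is Some v' then coef (mgdif F i) u' v' else 0
  else 0.

Lemma coefnE i (u : 'I_(mgrank (mgterm F i.+1))) (v : 'I_(mgrank (mgterm F i))) :
  coefn i u v = coef (mgdif F i) u v.
Proof. by rewrite /coefn !valK. Qed.

Definition res_base : bcplx K n := @BCplx K n base_set
  (fun b => tag b) (fun b => shift (tagged b))
  (fun b => [ffun b' : base_set =>
     if tag b == (tag b').+1 :> nat then coefn (tag b') (tagged b) (tagged b') else 0 : K^o]).

Definition base_row (i : 'I_p.+1) (v : {ffun base_set -> K^o}) :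
    'rV[K]_(mgrank (mgterm F i)) := \row_u (v (base_elt u) : K).

Definition base_vec (i : 'I_p.+1) (l : 'rV[K]_(mgrank (mgterm F i))) :
    {ffun base_set -> K^o} := \sum_u l 0 u *: ebasis K (base_elt u).

Lemma base_vec_neq0 i l b : @base_vec i l b != 0 ->
  exists2 u, b = base_elt u & l 0 u != 0.
Proof.
move=> nz; apply: contra_notP (negP nz) => no.
rewrite /base_vec sum_ffunE big1 // => u _; rewrite !ffunE.
case: (b =P base_elt u) => [E|_]; last exact: mulr0.
have [->|lu] := eqVneq (l 0 u) 0; first exact: mul0r.
by case: no; exists u.
Qed.

Lemma base_vecE i l u : @base_vec i l (base_elt u) = l 0 u.
Proof.
rewrite /base_vec sum_ffunE (bigD1 u) //= big1 ?addr0.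
  by rewrite !ffunE eqxx; exact: mulr1.
move=> v neq; rewrite !ffunE; case: eqP => [E|_]; last exact: mulr0.
by case/eqP: neq; apply/esym; exact: eq_from_Tagged E.
Qed.

Lemma base_rowK (i : 'I_p.+1) (v : {ffun base_set -> K^o}) : bpure (B := res_base) i v ->
  base_vec (base_row i v) = v.
Proof.
move=> pv; apply/ffunP => -[j u]; have [E|neq] := eqVneq j i.
  by case: _ / E pv => _; rewrite -[existT _ _ _]/(base_elt u) base_vecE mxE.
transitivity (0 : K).
  apply/eqP; apply: contraTT neq => /base_vec_neq0[w /(congr1 tag) /= -> _].
  by rewrite eqxx.
apply/esym/eqP; apply: contraNT neq => /pv /= E; apply/eqP; exact: val_inj.
Qed.

Lemma base_vec_inj_row (i : 'I_p.+1) (v w : {ffun base_set -> K^o}) :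
  bpure (B := res_base) i v -> bpure (B := res_base) i w ->
  base_row i v = base_row i w -> v = w.
Proof. by move=> /base_rowK {2}<- /base_rowK {2}<- ->. Qed.

Lemma base_row_below i d v : bbelow (B := res_base) d v -> below d (base_row i v).
Proof. by move=> bv u; rewrite mxE; apply: contraNeq => /bv. Qed.

Lemma base_vec_below i d l : below d l -> bbelow (B := res_base) d (@base_vec i l).
Proof.
by move=> bl b /base_vec_neq0[u ->]; apply: contraNT => /bl->.
Qed.

Lemma base_vec_pure (i : 'I_p.+1) l : bpure (B := res_base) i (@base_vec i l).
Proof. by move=> b /base_vec_neq0[u ->]. Qed.

Lemma base_row_vec i l : base_row i (@base_vec i l) = l.
Proof. by apply/rowP => u; rewrite mxE base_vecE. Qed.

Lemma base_row_bdif (i : 'I_p.+1) (lt_i : (i.+1 < p.+1)%N) v :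
  base_row i (lin (@bdif _ _ res_base) v) =
  base_row (Ordinal lt_i) v *m coef (mgdif F i).
Proof.
apply/rowP => w; rewrite !mxE /lin sum_ffunE.
transitivity (\sum_(j < p.+1) \sum_(u < mgrank (mgterm F j))
  (v (base_elt u) : K) * (bdif (base_elt u : bset res_base) (base_elt w) : K)).
  by rewrite sig_big_dep; apply: eq_bigr => -[j u] _; rewrite ffunE.
rewrite (bigD1 (Ordinal lt_i)) //= [X in _ + X]big1 ?addr0.
  by apply: eq_bigr => u _; rewrite !mxE ffunE /= eqxx coefnE.
move=> j neq; rewrite big1 // => u _; rewrite ffunE /=.
case: eqP => [E|_]; last by rewrite mulr0.
by case/eqP: neq; apply: val_inj.
Qed.

Lemma base_row_top (i : 'I_p.+1) v : ~~ (i.+1 < p.+1)%N ->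
  base_row i (lin (@bdif _ _ res_base) v) = 0.
Proof.
move=> top; apply/rowP => w; rewrite !mxE /lin sum_ffunE big1 // => -[j u] _.
rewrite !ffunE /=; case: eqP => [E|_]; last exact: mulr0.
by rewrite -E ltn_ord in top.
Qed.

Let lt_or_rank0 (i : nat) : (i < p.+1)%N \/ mgrank (mgterm F i) = 0%N.
Proof. by case: (leqP i p) => [|/F_len]; [left | right]. Qed.

Let rank0_row r : r = 0%N -> forall l : 'rV[K]_r, l = 0.
Proof. by move=> r0 l; apply/rowP => u; have := ltn_ord u; rewrite [X in (_ < X)%N]r0. Qed.

Lemma mgdif_exact i : coef (mgdif F i.+1) *m coef (mgdif F i) = 0 /\
  forall d l, below d l -> l *m coef (mgdif F i) = 0 ->
    exists2 l', below d l' & l = l' *m coef (mgdif F i.+1).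
Proof. by apply: strands_of_exact; case: F_res => -[_ _ exF] _ _; apply: exF. Qed.

Lemma res_base_minimal : bminimal res_base.
Proof.
split=> [[i u] [j v]|b].
  rewrite ffunE /=; case: (nat_of_ord i =P j.+1) => [E|_]; last by rewrite eqxx.
  case: i u E => i lt_i /= u E; subst i; rewrite coefnE => nz.
  have le : (shift v <= shift u)%MM by apply: contraNT nz => /coef_eq0->.
  split=> //; rewrite ltn_neqAle mdeg_mono // andbT.
  apply: contra nz => /eqP eqd.
  have sub0 : (shift u - shift v)%MM = 0%MM.
    by apply/eqP; rewrite -mdeg_eq0 mdegBE // eqd subnn.
  case: F_res => _ _ /(_ j u v) /maxideal_const.
  by rewrite /= mxE sub0 mcoeffZ mcoeffX eqxx mulr1 => ->.
apply/ffunP => -[i w]; rewrite [RHS]ffunE.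
suff /rowP/(_ w) : base_row i (lin (@bdif _ _ res_base) (@bdif _ _ res_base b)) = 0.
  by rewrite !mxE.
have [lt_i|top] := boolP (i.+1 < p.+1)%N; last exact: base_row_top.
rewrite (base_row_bdif lt_i).
rewrite -[@bdif _ _ res_base b](lin_ebasis (@bdif _ _ res_base)).
have [lt_i2|top] := boolP (i.+2 < p.+1)%N; last by rewrite base_row_top ?mul0mx.
by rewrite (@base_row_bdif (Ordinal lt_i) lt_i2) -mulmxA (mgdif_exact i).1 mulmx0.
Qed.

Lemma res_base_exact : bexact res_base.
Proof.
move=> d j v bv pv v0.
have [lt_j|/rank0_row r0] := lt_or_rank0 j.+1; last first.
  exists 0; first by move=> b; rewrite ffunE eqxx.
  rewrite linear0; apply/ffunP => b; rewrite [RHS]ffunE; apply/eqP.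
  apply: contraT => /pv; case: b => [[i lt_i] u] /= E; subst i.
  by have /rowP/(_ u) := r0 (delta_mx 0 u); rewrite !mxE !eqxx => /eqP; rewrite oner_eq0.
have lt_j' : (j < p.+1)%N by apply: ltnW.
have l0 : base_row (Ordinal lt_j) v *m coef (mgdif F j) = 0.
  rewrite -(@base_row_bdif (Ordinal lt_j') lt_j) v0.
  by apply/rowP => u; rewrite !mxE ffunE.
have [l bl lE] := (mgdif_exact j).2 _ _ (base_row_below (i := Ordinal lt_j) bv) l0.
have [lt_j2|/rank0_row r0] := lt_or_rank0 j.+2.
  exists (base_vec (i := Ordinal lt_j2) l); first exact: base_vec_below.
  apply: (@base_vec_inj_row (Ordinal lt_j)) => //.
    apply: bpure_bdif; first exact: res_base_minimal.
    exact: (@base_vec_pure (Ordinal lt_j2)).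
  by rewrite (@base_row_bdif (Ordinal lt_j) lt_j2) base_row_vec.
exists 0; first by move=> b; rewrite ffunE eqxx.
rewrite linear0 -(base_rowK (i := Ordinal lt_j) pv) lE (r0 l) mul0mx.
by rewrite /base_vec big1 // => u _; rewrite mxE scale0r.
Qed.

Hypothesis M_graded : multigraded M.
Variables (G1 G0 : mgfree n) (phi : mghom K G1 G0).
Variable a : {linear 'rV[S]_(mgrank G0) -> M}.
Hypothesis G_pres : is_mgpresentation phi a.

(** M^* is defined through an arbitrary presentation, while its resolution is built from F; a
    multigraded map F_0 -> G_0 over [M] links the two. *)
Lemma comparison_ex (u : 'I_(mgrank (mgterm F 0))) :
  exists2 l : 'rV[K]_(mgrank G0), below (shift u) l &
    a (unstrand (shift u) l) = mgaug F (delta_mx 0 u).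
Proof.
case: G_pres => homa sa _; case: F_res => _ homF _.
by apply: mgcomp_lift => //; apply: homF.
Qed.

Definition comparison_mx : 'M[K]_(mgrank (mgterm F 0), mgrank G0) :=
  \matrix_(u, v) projT1 (cid2 (comparison_ex u)) 0 v.

Lemma row_comparison u : row u comparison_mx = projT1 (cid2 (comparison_ex u)).
Proof. by apply/rowP => v; rewrite !mxE. Qed.

Lemma comparison_eq0 u v : ~~ (shift v <= shift u)%MM -> comparison_mx u v = 0.
Proof. by move=> nle; rewrite mxE; case: cid2 => l /= bl _; apply: bl. Qed.

Definition comparison : mghom K (mgterm F 0) G0 := MgHom comparison_eq0.

Lemma aug_comparison r : a (r *m mghom_mx comparison) = mgaug F r.
Proof.
rewrite (row_sum_delta r) mulmx_suml !linear_sum; apply: eq_bigr => u _.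
rewrite -scalemxAl !linearZ; congr (_ *: _).
rewrite -{1}(unstrand_delta K u) unstrand_mul; last exact: below_delta.
by rewrite -rowE row_comparison; case: cid2.
Qed.

Definition base_lam (b : base_set) : 'rV[K]_(mgrank G0) :=
  base_row ord0 (ebasis K b) *m comparison_mx.

Lemma lin_base_lam v : lin base_lam v = base_row ord0 v *m comparison_mx.
Proof.
rewrite /lin /base_lam.
transitivity ((\sum_b v b *: base_row ord0 (ebasis K b)) *m comparison_mx).
  by rewrite mulmx_suml; apply: eq_bigr => b _; rewrite scalemxAl.
congr (_ *m _); apply/rowP => u; rewrite summxE !mxE.
rewrite (bigD1 (base_elt u)) //= big1 ?addr0; first by rewrite !mxE ffunE eqxx mulr1.
by move=> b neq; rewrite !mxE ffunE eq_sym (negPf neq) mulr0.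
Qed.

Lemma comparison_unstrand d l : below d l ->
  a (unstrand d (l *m comparison_mx)) = mgaug F (unstrand d l).
Proof. by move=> bl; rewrite -(unstrand_mul comparison) // aug_comparison. Qed.

Lemma presentation_strand d l : below d l -> a (unstrand d l) = 0 ->
  exists2 z, below d z & l = z *m coef phi.
Proof.
case: G_pres => _ _ ex bl /ex[b bE]; exists (strand d b); first exact: below_strand.
by rewrite -strand_mul -bE strandK.
Qed.

(** Since [comparison] lies over [M], and F_1 and G_1 cover the kernels of the two maps onto [M],
    the cokernel of [phi] in each multidegree is that of F_1 -> F_0. *)
Lemma res_base_resolves : @resolves_coker K n res_base _ _ phi base_lam.
Proof.
have minB := res_base_minimal.
have rowB d v : bbelow (B := res_base) d v -> below d (base_row ord0 v).
  exact: base_row_below.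
split=> //; first exact: res_base_exact.
- case=> i u v; rewrite /base_lam mxE => nz.
  have [w] : exists w, base_row ord0 (ebasis K (existT _ i u : base_set)) 0 w * comparison_mx w v != 0.
    apply/existsP; rewrite -negb_forall; apply: contra nz => /forallP z.
    by rewrite big1 // => w _; apply/eqP; rewrite z.
  rewrite mxE ffunE; case: (base_elt w =P existT _ i u) => [<-|_]; last by rewrite mul0r eqxx.
  by rewrite mul1r => nzw; apply: contraNT nzw => /comparison_eq0->.
- move=> b; rewrite -[bdif b](lin_ebasis (@bdif _ _ res_base)) lin_base_lam.
  have bb : bbelow (B := res_base) (bsh (b : bset res_base)) (ebasis K b).
    by move=> b' /ebasis_neq0->; apply: lepm_refl.
  have [lt1|top] := boolP (1 < p.+1)%N; last first.
    exists 0; first by move=> u; rewrite mxE.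
    by rewrite base_row_top // !mul0mx.
  rewrite (@base_row_bdif ord0 lt1); set l := base_row _ _.
  have bl : below (bsh (b : bset res_base)) l by apply: base_row_below.
  apply: presentation_strand.
    by apply: (below_mul comparison); apply: below_mul.
  rewrite comparison_unstrand; last exact: below_mul.
  rewrite -unstrand_mul //; case: F_res => -[_ ex _] _ _.
  by apply/ex; eexists.
- move=> d v z bv pv bz; rewrite lin_base_lam => E; have bl := rowB _ _ bv.
  have : a (unstrand d (base_row ord0 v *m comparison_mx)) = 0.
    by rewrite E -unstrand_mul //; case: G_pres => _ _ ex; apply/ex; eexists.
  rewrite comparison_unstrand //; case: F_res => -[_ ex _] _ _ /ex[b bE].
  have lE : base_row ord0 v = strand d b *m coef (mgdif F 0).
    by rewrite -strand_mul -bE strandK.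
  have [lt1|/rank0_row r0] := lt_or_rank0 1.
    exists (base_vec (i := Ordinal lt1) (strand d b)).
      exact/base_vec_below/below_strand.
    apply: (@base_vec_inj_row ord0) => //.
      by apply: bpure_bdif => //; exact: (@base_vec_pure (Ordinal lt1)).
    by rewrite (@base_row_bdif ord0 lt1) base_row_vec.
  exists 0; first by move=> b'; rewrite ffunE eqxx.
  rewrite linear0 -(base_rowK (i := ord0) pv) lE (r0 (strand d b)) mul0mx.
  by rewrite /base_vec big1 // => u _; rewrite mxE scale0r.
- move=> d y by_; case: G_pres => homa sa exa; case: F_res => -[sF _ _] homF _.
  have yd := mgcomp_unstrand M_graded homa by_.
  have [l bl lE] := mgcomp_lift M_graded homF (sF _) yd.
  have [||z bz zE] := @presentation_strand d (y - l *m comparison_mx).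
  + by move=> u nle; rewrite mxE by_ // mxE (below_mul comparison bl) // subr0.
  + have -> : unstrand d (y - l *m comparison_mx) =
        unstrand d y - unstrand d (l *m comparison_mx) :> 'rV[S]_(mgrank G0).
      by apply/rowP => u; rewrite !mxE scalerBl.
    by rewrite linearB /= comparison_unstrand // lE subrr.
  exists (base_vec (i := ord0) l), z; split=> //.
  + exact: base_vec_below.
  + exact: (@base_vec_pure ord0).
  + by rewrite lin_base_lam base_row_vec -zE addrC subrK.
Qed.

End ResolutionBase.

(** * Betti numbers and projective dimension *)

Section ExpandedBetti.
Variables (K : fieldType) (n : nat) (e : 'I_n -> nat).
Hypothesis e_gt0 : forall k, (0 < e k)%N.
Local Notation N := (nvars e).
Local Notation ls := (all_splits e_gt0).

Definition degree_weight (j : nat) (k : int) (h : nat) (a : 'X_{1..N}) : nat :=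
  (h == j) && ((mdeg a)%:Z == k).

Section Expanded.
Variables (B : bcplx K n) (G1 G0 : mgfree n) (phi : mghom K G1 G0).
Variable lam : bset B -> 'rV[K]_(mgrank G0).
Hypothesis res : resolves_coker phi lam.
Variables (T : grmod K N) (pi : {linear starmod K e G0 -> T}).
Hypothesis pi_onto : forall t, exists y, pi y = t.
Hypothesis pi_ker : forall y, pi y = 0 <-> exists z : starmod K e G1, star_map phi z = y.
Hypothesis pi_homog : forall c t,
  mgcomp c t <-> exists2 y : star_free K e G0, mgcomp c y & t = pi y.

Lemma card_bterm (A : bcplx K N) j (P : pred 'X_{1..N}) :
  #|[set u : 'I_(mgrank (bterm A j)) | P (shift u)]| =
  (\sum_(b : bset A) ((bhd b == j) && P (bsh b)))%N.
Proof.
rewrite -sum1_card big_mkcond.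
transitivity (\sum_(u < mgrank (bterm A j)) P (bsh (enum_val u)))%N.
  by apply: eq_bigr => u _; rewrite inE; case: (P _).
rewrite -(big_enum_val (A := [pred b : bset A | bhd b == j]) (fun b => P (bsh b) : nat)).
rewrite big_mkcond; apply: eq_bigr => b _; rewrite inE.
by case: eqP.
Qed.

(** The predicate [P] is left free because Betti numbers select generators by total degree, while
    the projective dimension needs the full ranks. *)
Lemma expanded_res_ex : exists X : mgcplx T,
  [/\ is_min_mgresolution X, lifts_multidegrees X &
    forall j (P : pred 'X_{1..N}), #|[set u : 'I_(mgrank (mgterm X j)) | P (shift u)]| =
      (\sum_(b : bset B) splits_weight ls (fun h a => (h == j) && P a)
         (bhd b) (iota_mnm e_gt0 (bsh b)))%N].
Proof.
have [||minE [eps epsP]] := @splits_expands K N ls (embed e_gt0 B) (all_splits_fresh e_gt0).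
- exact: embed_minimal res.
- by move=> b y yl; apply: iota_split.
exists (expanded_cplx res minE epsP pi); split.
- exact: expanded_resolution.
- exact: expanded_lifts.
- move=> j P; rewrite card_bterm.
  exact: (splits_sum ls (fun h a => (h == j) && P a : nat) (embed e_gt0 B)).
Qed.

Lemma betti_expanded (j : nat) k : betti T j k =
  (\sum_(b : bset B) splits_weight ls (degree_weight j k) (bhd b) (iota_mnm e_gt0 (bsh b)))%N.
Proof.
have [X [minX liX cardX]] := expanded_res_ex.
by rewrite (betti_mgcplx minX liX) (cardX j (fun a => (mdeg a)%:Z == k)).
Qed.

Lemma projdim_expanded : projdim T = esup (fun r => exists j : nat,
  (\sum_(b : bset B) splits_weight ls (fun h a => h == j) (bhd b) (iota_mnm e_gt0 (bsh b)) != 0)%N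
  /\ r = efin j%:Z).
Proof.
have [X [[resX _ minX] _ cardX]] := expanded_res_ex.
rewrite (projdim_minimal resX minX); congr esup; apply/funext => r; apply/propext.
have rankE j : rank (mgcplx_free X) j = (\sum_(b : bset B)
    splits_weight ls (fun h a => h == j) (bhd b) (iota_mnm e_gt0 (bsh b)))%N.
  have := cardX j predT; rewrite cardsE card_ord /= => ->.
  by apply: eq_bigr => b _; apply: splits_weight_shift => k a; rewrite andbT.
by split=> -[j [rj ->]]; exists j; split=> //; [rewrite -rankE; apply/eqP | rewrite rankE; apply/eqP].
Qed.

End Expanded.

Lemma betti_star_free (G : mgfree n) (j : nat) k : betti (star_free K e G) j k =
  (\sum_(u < mgrank G) splits_weight ls (degree_weight j k) 0 (iota_mnm e_gt0 (shift u)))%N.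
Proof.
apply: (betti_expanded (free_base_resolves K G)
  (pi := (idfun : {linear starmod K e G -> star_free K e G}))).
- by move=> t; exists t.
- move=> y; split=> /= [->|[z <-]].
    by exists 0; apply: val_inj; rewrite /= mul0mx.
  by apply: val_inj; rewrite /=; apply/rowP => u; rewrite !mxE big_ord0.
- by move=> c t; split=> [ct|[y yc ->]]; first exists t.
Qed.

Section Coker.
Variables (G1 G0 : mgfree n) (phi : mghom K G1 G0).

Definition expansion_pi : starmod K e G0 -> expansion e phi :=
  coker_pi (star_map phi : {linear starmod K e G1 -> starmod K e G0}).

Lemma expansion_pi_linear : linear expansion_pi.
Proof.
by move=> c x y; rewrite /expansion_pi coker_piD coker_piZ.
Qed.

HB.instance Definition _ := GRing.isLinear.Build _ (starmod K e G0)
  (expansion e phi) _ expansion_pi expansion_pi_linear.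

Lemma expansion_pi_onto t : exists y, expansion_pi y = t.
Proof. by exists (coker_repr t); apply: coker_reprK. Qed.

Lemma expansion_pi_ker y :
  expansion_pi y = 0 <-> exists z : starmod K e G1, star_map phi z = y.
Proof.
have pi0 : expansion_pi 0 = 0 by exact: linear0.
rewrite -pi0 /expansion_pi coker_piP.
split=> -[z zE]; exists z; apply: etrans zE _; first exact: subr0.
exact: esym (subr0 _).
Qed.

End Coker.
End ExpandedBetti.

Section Numbers.
Variables (n : nat) (e : 'I_n -> nat).
Hypothesis e_gt0 : forall k, (0 < e k)%N.
Local Notation N := (nvars e).
Local Notation ls := (all_splits e_gt0).

(** The variable x_j0 is the source of one pair for each of the other [e j - 1] variables of its
    block. *)
Lemma splits_length_iota a :
  splits_length ls (iota_mnm e_gt0 a) = (\sum_(k < n | a k != 0) (e k).-1)%N.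
Proof.
rewrite /splits_length -sum1_count big_map big_filter_cond big_enum_cond /=.
transitivity (\sum_(j < n | a j != 0%N) \sum_(k < e j | k != Ordinal (e_gt0 j)) 1)%N.
  by rewrite sig_big_dep; apply: eq_bigl => p /=; rewrite iota_first andbC.
apply: eq_bigr => j _; rewrite sum1_card.
by rewrite -[RHS](congr1 predn (card_ord (e j))) -(cardC1 (Ordinal (e_gt0 j))).
Qed.

Lemma sum_pred_int a : (\sum_(k < n | a k != 0) (e k).-1)%N%:Z =
  \sum_(k < n | a k != 0%N :> nat) ((e k)%:Z - 1).
Proof.
rewrite (big_morph Posz PoszD (erefl _)); apply: eq_bigr => k _.
by rewrite -subn1 -subzn.
Qed.

Lemma degree_weight_shift j (k : int) i a : (i <= j)%N ->
  splits_weight ls (degree_weight j k) i a = splits_weight ls (degree_weight (j - i) k) 0 a.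
Proof.
move=> ij; apply: splits_weight_shift => h b; rewrite /degree_weight add0n.
by rewrite -{1}(subnKC ij) eqn_add2l.
Qed.

Lemma degree_weight_lt j (k : int) i a : (j < i)%N ->
  splits_weight ls (degree_weight j k) i a = 0%N.
Proof.
move=> ji; rewrite -[RHS](splits_weight0 ls i a).
apply: splits_weight_shift => h b; rewrite /degree_weight.
by rewrite gtn_eqF // ltn_addr.
Qed.

End Numbers.

Lemma is_esup_bigmax (I : finType) (f : I -> eint) (A : eint -> Prop) :
    (forall r, A r -> exists i, (r <= f i)%O) -> (forall i, A (f i)) ->
  is_esup A (\big[Order.max/eNoo]_i f i).
Proof.
move=> Af fA; split=> [r /Af[i le_r]|w ubw].
  by apply: le_trans le_r _; apply: le_bigmax.
by apply: bigmax_le => [|i _]; [exact: leNye | exact: ubw].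
Qed.

Lemma betti_neg (K : fieldType) (n : nat) (M : grmod K n) (j k : int) :
  j < 0 -> betti M j k = 0%N.
Proof. by case: j. Qed.

Lemma sum_nat_neq0 (I : finType) (f : I -> nat) :
  (\sum_i f i != 0)%N <-> exists i, f i != 0%N.
Proof.
rewrite sum_nat_eq0 negb_forall; split=> [/existsP[i fi]|[i fi]]; first by exists i.
by apply/existsP; exists i.
Qed.

(** * Betti numbers, regularity and projective dimension of M^* *)

Section MainTheorem.
Variables (K : fieldType) (n : nat) (e : 'I_n -> nat).
Hypothesis e_gt0 : forall k, (0 < e k)%N.
Variables (M : grmod K n) (M_graded : multigraded M).
Variables (p : nat) (F : mgcplx M) (F_res : is_min_mgresolution F).
Hypothesis F_len : forall i, (p < i)%N -> mgrank (mgterm F i) = 0%N.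
Variables (G1 G0 : mgfree n) (phi : mghom K G1 G0).
Variable a : {linear 'rV[{mpoly K[n]}]_(mgrank G0) -> M}.
Hypothesis G_pres : is_mgpresentation phi a.
Local Notation ls := (all_splits e_gt0).
Local Notation iota := (iota_mnm e_gt0).

Let expansion_homog c (t : expansion e phi) :
  mgcomp c t <-> exists2 y : star_free K e G0, mgcomp c y & t = expansion_pi phi y.
Proof. by []. Qed.

Let res := res_base_resolves F_res F_len M_graded G_pres.

Lemma sum_res_base (w : nat -> 'X_{1..n} -> nat) :
  (\sum_(b : bset (res_base p F)) w (bhd b) (bsh b) =
   \sum_(i < p.+1) \sum_(u < mgrank (mgterm F i)) w i (shift u))%N.
Proof. by rewrite [RHS]sig_big_dep. Qed.

Lemma betti_expansion (j : nat) k : betti (expansion e phi) j k =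
  (\sum_(i < p.+1) \sum_(u < mgrank (mgterm F i))
    splits_weight ls (degree_weight j k) i (iota (shift u)))%N.
Proof.
rewrite (betti_expanded e_gt0 res (@expansion_pi_onto _ _ e _ _ phi)
  (@expansion_pi_ker _ _ e _ _ phi) expansion_homog).
exact: (sum_res_base (fun i b => splits_weight ls (degree_weight j k) i (iota b))).
Qed.

Lemma betti_expansion_sum (j k : int) : betti (expansion e phi) j k =
  (\sum_(i < p.+1) betti (star_free K e (mgterm F i)) (j - i%:Z)%R k)%N.
Proof.
case: j => j; last first.
  rewrite [LHS]betti_neg // big1 // => i _; apply: betti_neg.
  by rewrite subr_lt0 (@lt_le_trans _ _ 0).
rewrite betti_expansion; apply: eq_bigr => i _.
have [ij|ji] := leqP i j; last first.
  (* Splitting never lowers the homological degree, so F_i contributes nothing below degree [i], in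
     accordance with the vanishing of Betti numbers of negative index. *)
  rewrite betti_neg ?subr_lt0 ?ltz_nat // big1 // => u _.
  exact: degree_weight_lt.
rewrite subzn // (betti_star_free K e_gt0); apply: eq_bigr => u _.
exact: degree_weight_shift.
Qed.

(** The Betti tables differ, but the sets of differences k - j coincide: homological and total
    degrees rise together under splitting, and the generators that raise neither recover every
    difference of [M]. *)
Lemma reg_expansion : reg M = reg (expansion e phi).
Proof.
have liF : lifts_multidegrees F.
  move=> d y yd; case: F_res => -[sF _ _] homF _.
  apply: (mgcomp_lift M_graded homF _ yd); exact: sF.
have bettiM := betti_mgcplx F_res liF.
congr esup; apply/funext => r; apply/propext; split=> -[j [k [nz ->]]].
  exists j, k; split=> //; case: j nz => // j.
  rewrite bettiM betti_expansion => /eqP; rewrite -lt0n => /card_gt0P[u].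
  rewrite inE => /eqP uk; apply/eqP/sum_nat_neq0.
  have lt_j : (j < p.+1)%N.
    by rewrite ltnNge; apply/negP => /F_len r0; have := ltn_ord u; rewrite [X in (_ < X)%N]r0.
  exists (Ordinal lt_j); apply/sum_nat_neq0; exists u.
  by apply: splits_weight_base; rewrite /degree_weight mdeg_iota uk !eqxx.
case: j nz => // j /eqP; rewrite betti_expansion => /sum_nat_neq0[i /sum_nat_neq0[u]].
move=> /(splits_weight_neq0 (all_splits_fresh e_gt0))[h [b [w0 _ _ degE]]].
exists (i : nat)%:Z, (mdeg (shift u))%:Z; split.
  apply/eqP; rewrite bettiM -lt0n; apply/card_gt0P; exists u.
  by rewrite inE.
congr EFin; move: w0; rewrite /degree_weight eqb0 negbK => /andP[/eqP hj /eqP <-].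
apply/eqP; rewrite subr_eq addrAC eq_sym subr_eq -!PoszD eqz_nat.
by rewrite mdeg_iota hj in degE; rewrite degE.
Qed.

(** [splits_weight_neq0] bounds the homological degrees over each summand, and
    [splits_weight_length] shows that the bound is attained. *)
Lemma projdim_expansion : projdim (expansion e phi) =
  \big[Order.max/eNoo]_(i < p.+1)
    \big[Order.max/eNoo]_(u < mgrank (mgterm F i))
      efin (i%:Z + \sum_(k < n | shift u k != 0%N) ((e k)%:Z - 1)).
Proof.
rewrite (projdim_expanded e_gt0 res (@expansion_pi_onto _ _ e _ _ phi)
  (@expansion_pi_ker _ _ e _ _ phi) expansion_homog).
apply: esup_eq; rewrite sig_big_dep /=.
have lenE (i : nat) (c : 'X_{1..n}) :
    i%:Z + \sum_(k < n | c k != 0%N) ((e k)%:Z - 1) =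
    (i + splits_length ls (iota c))%N%:Z.
  by rewrite PoszD splits_length_iota (sum_pred_int e_gt0).
apply: is_esup_bigmax => [_ [j [/sum_nat_neq0[b nz] ->]]|[i u] /=].
  have [h [c [hj _ hl _]]] := splits_weight_neq0 (all_splits_fresh e_gt0) nz.
  exists b; rewrite lenE lee_fin lez_nat.
  by move: hj; rewrite eqb0 negbK => /eqP <-.
exists (i + splits_length ls (iota (shift u)))%N; rewrite lenE; split=> //.
apply/sum_nat_neq0; exists (existT _ i u : bset (res_base p F)).
by apply: splits_weight_length => [|c]; [exact: all_splits_fresh | rewrite eqxx].
Qed.

End MainTheorem.

Theorem theorem4p2 (K : fieldType) (n : nat)
    (e : 'I_n -> nat) (e_gt0 : forall k, (0 < e k)%N)
    (M : grmod K n) (M_graded : multigraded M) (M_fg : finitely_generated M)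
    (* the minimal multigraded free resolution, of length at most p *)
    (p : nat) (F : mgcplx M) (F_res : is_min_mgresolution F)
    (F_len : forall i, (p < i)%N -> mgrank (mgterm F i) = 0%N)
    (* a multigraded free presentation, from which M^* is computed *)
    (G1 G0 : mgfree n) (phi : mghom K G1 G0)
    (a : {linear 'rV[{mpoly K[n]}]_(mgrank G0) -> M})
    (G_pres : is_mgpresentation phi a) :
  [/\ forall j k : int,
        betti (expansion e phi) j k =
        (\sum_(i < p.+1) betti (star_free K e (mgterm F i)) (j - i%:Z)%R k)%N,
      reg M = reg (expansion e phi)
    & projdim (expansion e phi) =
      \big[Order.max/eNoo]_(i < p.+1)
        \big[Order.max/eNoo]_(u < mgrank (mgterm F i))
          efin (i%:Z + \sum_(k < n | shift u k != 0%N) ((e k)%:Z - 1))].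
Proof.
split=> [j k||].
- exact: (betti_expansion_sum e_gt0 M_graded F_res F_len G_pres).
- exact: (reg_expansion e_gt0 M_graded F_res F_len G_pres).
- exact: (projdim_expansion e_gt0 M_graded F_res F_len G_pres).
Qed.
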